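(* The function $s\mapsto\Phi^L(\sigma,s)=\sigma^2s^2\log\big(1+d(\log d)/s^2\big)$ is the adaptive rate of convergence (as $d\to\infty$, in the sense defined in the context) on the scale of classes $\{\Theta_s,\ s=1,\dots,d\}$.
   Context: Model: for each $d$ one observes $y=(y_1,\dots,y_d)$ with $y_j=\theta_j+\sigma\xi_j$, where $\theta\in\mathbb{R}^d$ is unknown, $\xi_j$ are i.i.d. standard normal and $\sigma>0$ is known; $\mathbf{E}_\theta$ is the expectation under the law of $y$. $L(\theta)=\sum_{i=1}^d\theta_i$. $\Theta_s=\{\theta\in\mathbb{R}^d:\|\theta\|_0\le s\}$, where $\|\theta\|_0$ is the number of nonzero components. An estimator is a real-valued measurable function of $y$ (it may depend on $d$ and $\sigma$, but not on $s$). $\log$ is the natural logarithm. Definition. Let $d$ range over the integers $d\ge2$. A function $s\mapsto\Psi_d(s)>0$ is called the adaptive rate of convergence on the scale of classes $\{\Theta_s,\ s=1,\dots,d\}$ if: (i) there exist an estimator $\hat L$ (one for each $d$) and a constant $C>0$ not depending on $d$ such that, for all $d$, $$\max_{s=1,\dots,d}\ \sup_{\theta\in\Theta_s}\mathbf{E}_\theta(\hat L-L(\theta))^2/\Psi_d(s)\le C;$$ (ii) if there exist another function $s\mapsto\Psi_d'(s)>0$ and a constant $C'>0$ such that, for all $d$, $$\inf_{\hat T}\max_{s=1,\dots,d}\ \sup_{\theta\in\Theta_s}\mathbf{E}_\theta(\hat T-L(\theta))^2/\Psi_d'(s)\le C'$$ (infimum over all estimators) and $$\min_{s=1,\dots,d}\frac{\Psi'_d(s)}{\Psi_d(s)}\to0\quad\text{as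 } d\to\infty,$$ then there exists $\bar s\in\{1,\dots,d\}$ (possibly depending on $d$) such that $$\frac{\Psi'_d(\bar s)}{\Psi_d(\bar s)}\ \min_{s=1,\dots,d}\frac{\Psi'_d(s)}{\Psi_d(s)}\to\infty\quad\text{as } d\to\infty.$$ *)

(* Defs.v *)
From HB Require Import structures.
From mathcomp Require Import all_boot all_order all_algebra.
From mathcomp Require Import all_classical all_reals all_analysis.

Set Implicit Arguments.
Unset Strict Implicit.
Unset Printing Implicit Defensive.

Import Order.TTheory GRing.Theory Num.Theory.
Import numFieldNormedType.Exports.

Local Open Scope classical_set_scope.
Local Open Scope ring_scope.

Section cons_pair.
Context (R : realType) (n : nat).

(* [normal_prob] lives on [measurableTypeR R], i.e. R with its Borel sets. *)
Definition cons_pair (p : measurableTypeR R * n.-tuple R) : n.+1.-tuple R :=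
  [the n.+1.-tuple R of (p.1 : R) :: p.2].

Lemma measurable_cons_pair :
  measurable_fun [set: measurableTypeR R * n.-tuple R] cons_pair.
Proof. by apply: (@measurable_cons _ _ _ R). Qed.

HB.instance Definition _ :=
  isMeasurableFun.Build _ _ _ _ cons_pair measurable_cons_pair.

End cons_pair.

(* The law of (xi_1, ..., xi_n) with xi_j i.i.d. standard normal, i.e. the
   n-fold product of N(0, 1); [gauss_noise_rect] below characterizes it. *)
Fixpoint gauss_noise (R : realType) (n : nat) : probability (n.-tuple R) R :=
  match n with
  | 0 => \d_([tuple] : 0.-tuple R)
  | m.+1 => distribution (normal_prob (0 : R) 1 \x gauss_noise R m)%E
              (@cons_pair R m)
  end.

Lemma gauss_noise_rect (R : realType) (n : nat) (A : 'I_n -> set R) :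
  (forall i, measurable (A i)) ->
  gauss_noise R n [set x | forall i, A i (tnth x i)] =
    (\prod_(i < n) normal_prob (0 : R) 1 (A i))%E.
Proof.
elim: n A => [|n IH] A mA.
  rewrite big_ord0 /= diracE mem_set//=.
  by case.
rewrite big_ord_recl -IH; last by move=> i; exact: mA.
rewrite /= /distribution /pushforward.
rewrite [X in (_ \x _)%E X](_ : _ =
    A ord0 `*` [set x : n.-tuple R | forall i, A (lift ord0 i) (tnth x i)]).
  rewrite product_measure1E//; first exact: mA.
  rewrite [X in measurable X](_ : _ =
      \bigcap_(i in [set: 'I_n]) ((@tnth n R ^~ i) @^-1` A (lift ord0 i))).
    apply: fin_bigcap_measurable => // i _.
    rewrite -[X in measurable X]setTI.
    by apply: (@measurable_tnth _ _ n i measurableT); exact: mA.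
  by apply/seteqP; split=> x /= H; [move=> i _; exact: H|move=> i; exact: H].
apply/seteqP; split=> [[a x] /= H|[a x] /= [H0 H] i].
  split=> [|i]; first by have := H ord0; rewrite tnth0.
  by have := H (lift ord0 i); rewrite tnthS.
by case: (unliftP ord0 i) => [j|] ->; rewrite ?tnthS ?tnth0.
Qed.

Section model.
Context (R : realType) (sigma : R) (d : nat).

(* y = theta + sigma * xi *)
Definition observe (theta xi : d.-tuple R) : d.-tuple R :=
  [tuple tnth theta j + sigma * tnth xi j | j < d].

Lemma measurable_observe theta :
  measurable_fun [set: d.-tuple R] (observe theta).
Proof.
apply/measurable_fun_tnthP => j.
rewrite (_ : _ \o _ = fun x => tnth theta j + sigma * tnth x j); last first.
  by apply/funext => x /=; rewrite tnth_mktuple.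
apply: measurable_realfun.measurable_funD => //; apply: measurable_realfun.measurable_funM => //.
exact: measurable_tnth.
Qed.

HB.instance Definition _ theta := isMeasurableFun.Build _ _ _ _
  (observe theta) (measurable_observe theta).

Definition obs_law (theta : d.-tuple R) : probability (d.-tuple R) R :=
  distribution (gauss_noise R d) (observe theta).

Definition estimator := {mfun d.-tuple R >-> R}.

Definition Lsum (theta : d.-tuple R) : R := \sum_(i < d) tnth theta i.

Definition norm0 (theta : d.-tuple R) : nat := #|[pred i | tnth theta i != 0]|.

Definition Theta (s : nat) : set (d.-tuple R) :=
  [set theta | (norm0 theta <= s)%N].

(* Takes the value +oo when the squared error is not integrable. *)
Definition risk (T : estimator) (theta : d.-tuple R) : \bar R :=
  ('E_(obs_law theta)[fun y => ((T y - Lsum theta) ^+ 2)%R])%E.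

Definition max_risk (psi : nat -> R) (T : estimator) : \bar R :=
  (\big[maxe/-oo]_(1 <= s < d.+1)
     ereal_sup [set risk T theta * (psi s)^-1%:E | theta in Theta s])%E.

End model.

(* For d >= 1 the initial value f 1 is itself one of the terms, so this is
   min_{s = 1, ..., d} f s; d = 0 is never used. *)
Definition min_upto (R : realType) (d : nat) (f : nat -> R) : R :=
  \big[Order.min/f 1%N]_(1 <= s < d.+1) f s.

Definition positive_rate (R : realType) (Psi : nat -> nat -> R) : Prop :=
  forall d s : nat, (2 <= d)%N -> (1 <= s <= d)%N -> 0 < Psi d s.

Definition adaptive_upper_bound (R : realType) (sigma : R)
    (Psi : nat -> nat -> R) : Prop :=
  exists Lhat : forall d : nat, estimator R d, exists2 C : R, 0 < C &
    forall d : nat, (2 <= d)%N ->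
      (max_risk sigma (Psi d) (Lhat d) <= C%:E)%E.

Definition adaptive_optimality (R : realType) (sigma : R)
    (Psi : nat -> nat -> R) : Prop :=
  forall Psi' : nat -> nat -> R, positive_rate Psi' ->
  (exists2 C' : R, 0 < C' &
     forall d : nat, (2 <= d)%N ->
       (ereal_inf [set max_risk sigma (Psi' d) T | T in [set: estimator R d]]
          <= C'%:E)%E) ->
  (fun d => min_upto d (fun s => Psi' d s / Psi d s)) @ \oo --> (0 : R) ->
  exists2 sbar : nat -> nat,
    (forall d : nat, (2 <= d)%N -> (1 <= sbar d <= d)%N) &
    (fun d => Psi' d (sbar d) / Psi d (sbar d) *
              min_upto d (fun s => Psi' d s / Psi d s)) @ \oo --> +oo.

Definition adaptive_rate (R : realType) (sigma : R)
    (Psi : nat -> nat -> R) : Prop :=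
  [/\ positive_rate Psi, adaptive_upper_bound sigma Psi
    & adaptive_optimality sigma Psi].

Definition PhiL (R : realType) (sigma : R) (d s : nat) : R :=
  sigma ^+ 2 * s%:R ^+ 2 * ln (1 + d%:R * ln d%:R / s%:R ^+ 2).

(* Main.v *)
(* Upper bound. Hard thresholds tau_i = 8 sqrt i (in units of sigma) decrease
   along i = K, ..., 0, where 4^K is of order d log d, and level i corresponds
   to the sparsity 2^(K - i). The sum of the y_j above the top threshold is kept
   as it is; for each i < K, the sum of the y_j lying between tau_i and tau_(i+1)
   is kept only if it exceeds a constant times 2^(K - i) sqrt (i + 1), which is
   the square root of the rate at sparsity 2^(K - i). If theta is s-sparse, every
   band with 2^(K - i) <= s costs at most its cut, and these cuts add up
   geometrically. In a band with 2^(K - i) > s the signal is deterministically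
   below half the cut, so the band survives only if its pure noise part is large,
   which exponential moments bounded by exp (C K) make negligible.

   Lower bound. Put s spikes of height sigma sqrt (log E) at uniform positions in
   s disjoint blocks of length m = d / s. The likelihood ratio M of the mixture
   against theta = 0 satisfies E_0 M^2 <= V := exp (s (E - 1) / m), and
   integrating a pointwise quadratic inequality yields
   (total spike)^2 / 2 <= (risk on Theta_s) + 2 V (risk at 0).
   With E - 1 = m / s this shows that no rate beats PhiL at any s by more than a
   factor of order log d, and that a rate beating PhiL by a factor tending to 0
   can do so only at s >= d^(1/4). With E - 1 = (m / s) (log d) / 4 it shows that
   such a gain forces a risk at 0, hence Psi'(1), of order at least d^(1/4),
   so sbar = 1 works. *)

Require Import Defs.
From HB Require Import structures.
From mathcomp Require Import all_boot all_order all_algebra.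
From mathcomp Require Import all_classical all_reals all_analysis.
From mathcomp Require Import measurable_realfun ring lra.

Set Implicit Arguments.
Unset Strict Implicit.
Unset Printing Implicit Defensive.

Import Order.TTheory GRing.Theory Num.Theory.
Import numFieldNormedType.Exports.

Local Open Scope classical_set_scope.
Local Open Scope ring_scope.

(** * The standard normal law *)

Section standard_normal.
Context {R : realType}.
Implicit Types (f : R -> \bar R) (c : R).
Local Notation mu := (@lebesgue_measure R).
Local Notation N01 := (@normal_prob R 0 1).

(** The Radon-Nikodym derivative of the normal law and [normal_pdf] have the same integral over
    every measurable set, hence agree almost everywhere. *)
Lemma ge0_integral_normal_prob (m s : R) f :
  measurable_fun [set: R] f -> (forall x, 0 <= f x)%E ->
  (\int[normal_prob m s]_x f x = \int[mu]_x (f x * (normal_pdf m s x)%:E))%E.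
Proof.
move=> mf f0.
rewrite -(Radon_Nikodym_SigmaFinite.change_of_variables
  (@normal_prob_dominates R m s))//.
set g := Radon_Nikodym_SigmaFinite.f _ _.
have ig : mu.-integrable [set: R] g.
  by apply: Radon_Nikodym_SigmaFinite.f_integrable; exact: normal_prob_dominates.
have mg := measurable_int _ ig.
have mpdf : measurable_fun [set: R] (EFin \o normal_pdf m s).
  by apply/measurable_EFinP; apply: measurable_normal_pdf.
apply: ae_eq_integral => //; [exact: emeasurable_funM..|].
apply: ae_eqe_mul2l; apply: integral_ae_eq => // A _ mA.
rewrite -Radon_Nikodym_SigmaFinite.f_integral//.
exact: normal_prob_dominates.
Qed.

Lemma lebesgue_measure_shift c (A : set R) : measurable A ->
  pushforward mu (fun x : measurableTypeR R => (x + c : measurableTypeR R)) A = mu A.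
Proof.
move=> mA; apply/esym.
have mc : measurable_fun setT (fun x : measurableTypeR R => (x + c : measurableTypeR R)).
  exact: measurable_funD.
pose h : {mfun measurableTypeR R >-> measurableTypeR R} :=
  HB.pack (fun x : measurableTypeR R => (x + c : measurableTypeR R)) (isMeasurableFun.Build _ _ _ _ _ mc).
apply: (@lebesgue_measure_unique R (pushforward mu h)) => // _ [[a b]] _ <-.
transitivity (mu `]a - c, b - c]%classic); last first.
  congr (mu _); apply/seteqP.
  by split=> x /=; rewrite !in_itv/= ?ltrBlDr ?lerBrDr.
by rewrite !lebesgue_measure_itv/= !lte_fin ltrD2r !EFinN -!EFinD opprD opprK addrACA addNr addr0.
Qed.

Lemma normal_pdf01 (x : R) : normal_pdf 0 1 x = (Num.sqrt (pi *+ 2))^-1 * expR (- x ^+ 2 / 2).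
Proof.
by rewrite normal_pdfE ?oner_neq0// /normal_peak /normal_fun expr1n mul1r subr0.
Qed.

(** Cameron-Martin in dimension one: translation invariance of Lebesgue measure moves the shift onto
    the density, and phi(x - c) / phi(x) is the exponential weight. *)
Lemma integral_normal_shift c f :
  measurable_fun [set: R] f -> (forall x, 0 <= f x)%E ->
  (\int[N01]_x f (x + c)%R =
   \int[N01]_x (f x * (expR (c * x - c ^+ 2 / 2))%:E))%E.
Proof.
move=> mf f0.
have mc : measurable_fun setT (fun x : R => x + c).
  exact: measurable_funD.
have me : measurable_fun setT (fun x : R => f x * (expR (c * x - c ^+ 2 / 2))%:E)%E.
  apply: emeasurable_funM => //; apply/measurable_EFinP.
  apply: measurableT_comp => //; apply: measurable_funB => //.
rewrite !ge0_integral_normal_prob//; last 2 first.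
- by move=> x; rewrite mule_ge0// lee_fin expR_ge0.
- exact: (measurableT_comp mf mc).
set g := fun y => (f y * (normal_pdf 0 1 (y - c)%R)%:E)%E.
have mg : measurable_fun setT g.
  apply: emeasurable_funM => //; apply/measurable_EFinP.
  apply: (measurableT_comp (measurable_normal_pdf _ _)).
  exact: measurable_funB.
have g0 y : (0 <= g y)%E by rewrite mule_ge0// lee_fin normal_pdf_ge0.
transitivity (\int[mu]_x g (x + c)%R)%E.
  by apply: eq_integral => x _; rewrite /g addrK.
transitivity (\int[mu]_x g x)%E.
  have mc' : measurable_fun setT
      (fun x : measurableTypeR R => (x + c : measurableTypeR R)).
    exact: measurable_funD.
  rewrite -[LHS](@ge0_integral_pushforward _ _ _ _ _ _ mc' mu setT g)//.
  by apply: eq_measure_integral => //= A mA _; exact: lebesgue_measure_shift.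
apply: eq_integral => x _; rewrite /g -muleA -EFinM; congr (_ * _%:E)%E.
rewrite !normal_pdf01 mulrCA -expRD; congr (_ * expR _).
by field.
Qed.

Lemma integral_normalN f :
  measurable_fun [set: R] f -> (forall x, 0 <= f x)%E ->
  (\int[N01]_x f (- x)%R = \int[N01]_x f x)%E.
Proof.
move=> mf f0.
have mN : measurable_fun setT (-%R : R -> R) by [].
rewrite !ge0_integral_normal_prob//; last exact: (measurableT_comp mf mN).
set g := fun y => (f y * (normal_pdf 0 1 y)%:E)%E.
have mg : measurable_fun setT g.
  by apply: emeasurable_funM => //; apply/measurable_EFinP; exact: measurable_normal_pdf.
have g0 y : (0 <= g y)%E by rewrite mule_ge0// lee_fin normal_pdf_ge0.
transitivity (\int[mu]_x g (- x)%R)%E.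
  by apply: eq_integral => x _; rewrite /g !normal_pdf01 sqrrN.
have mN' : measurable_fun setT (-%R : measurableTypeR R -> measurableTypeR R) by [].
rewrite -[LHS](@ge0_integral_pushforward _ _ _ _ _ _ mN' mu setT g)//.
by apply: eq_measure_integral => //= A mA _; exact: lebesgue_measureN.
Qed.

(** The weight turns the standard normal density into [Num.sqrt 2] times the density of N(0, 2). The
    moments of thresholded noise below all reduce to this one. *)
Lemma integral_normal_expR_sqr :
  (\int[N01]_x (expR (x ^+ 2 / 4))%:E = (Num.sqrt 2)%:E)%E.
Proof.
have m1 : measurable_fun setT (fun x : R => (expR (x ^+ 2 / 4))%:E).
  apply/measurable_EFinP; apply: measurableT_comp => //.
  by apply: measurable_funM => //; exact: measurable_funX.
rewrite ge0_integral_normal_prob// -[RHS]mule1 -(integral_normal_pdf 0 (Num.sqrt 2)).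
rewrite -ge0_integralZl//; first last.
- by move=> x _; rewrite lee_fin normal_pdf_ge0.
- by apply/measurable_EFinP; exact: measurable_normal_pdf.
apply: eq_integral => x _; rewrite -!EFinM; congr (_%:E).
rewrite normal_pdf01 normal_pdfE; last by rewrite sqrtr_eq0 -ltNge.
rewrite /normal_peak /normal_fun subr0 sqr_sqrtr//.
rewrite mulrCA -expRD mulrA; congr (_ * expR _); last by field.
rewrite -mulrnAr [in RHS]sqrtrM// invfM mulrA divff ?mul1r//.
Qed.

End standard_normal.

(** * Gaussian noise vectors *)

Section gaussian_noise.
Context {R : realType}.
Local Notation N01 := (@normal_prob R 0 1).

Lemma measurable_fun_cons (n : nat) (f : n.+1.-tuple R -> \bar R) (a : R) :
  measurable_fun setT f ->
  measurable_fun setT (fun x : n.-tuple R => f (cons_pair (a, x))).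
Proof.
move=> mf; apply: (measurableT_comp mf).
by apply: (@measurable_cons _ _ (n.-tuple R) R (cst a) n id).
Qed.

Lemma ge0_integral_gauss_noiseS (n : nat) (f : n.+1.-tuple R -> \bar R) :
  measurable_fun setT f -> (forall x, 0 <= f x)%E ->
  (\int[gauss_noise R n.+1]_x f x =
   \int[N01]_a \int[gauss_noise R n]_x f (cons_pair (a, x)))%E.
Proof.
move=> mf f0 /=.
rewrite ge0_integral_distribution// fubini_tonelli1//; last by move=> x; exact: f0.
by apply: (measurableT_comp mf); exact: measurable_cons_pair.
Qed.

Lemma measurable_prod_tnth (n : nat) (g : 'I_n -> R -> R) :
  (forall j, measurable_fun setT (g j)) ->
  measurable_fun setT (fun x : n.-tuple R => \prod_(j < n) g j (tnth x j)).
Proof.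
move=> mg; apply: measurable_prod => j _.
by apply: (measurableT_comp (mg j)); exact: measurable_tnth.
Qed.

Lemma integral_gauss_noise_prod (n : nat) (g : 'I_n -> R -> R) :
  (forall j, measurable_fun setT (g j)) -> (forall j x, 0 <= g j x) ->
  (\int[gauss_noise R n]_x (\prod_(j < n) g j (tnth x j))%:E =
   \prod_(j < n) \int[N01]_a (g j a)%:E)%E.
Proof.
elim: n g => [|n IH] g mg g0.
  rewrite big_ord0; under eq_integral do rewrite big_ord0.
  by rewrite integral_cst// mul1e; exact: (@probability_setT _ _ _ (gauss_noise R 0)).
rewrite ge0_integral_gauss_noiseS; last 2 first.
- by apply/measurable_EFinP; exact: measurable_prod_tnth.
- by move=> x; rewrite lee_fin prodr_ge0.
have mg0 : measurable_fun setT (EFin \o g ord0) by exact/measurable_EFinP.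
rewrite big_ord_recl -IH//.
set I := (\int[gauss_noise R n]_x _)%E.
rewrite -ge0_integralZr//; last 2 first.
- by move=> x _; rewrite lee_fin.
- by apply: integral_ge0 => x _; rewrite lee_fin; apply: prodr_ge0.
apply: eq_integral => a _.
rewrite -ge0_integralZl//; last 3 first.
- apply/measurable_EFinP.
  exact: (@measurable_prod_tnth _ (fun j => g (lift ord0 j))).
- by move=> x _; rewrite lee_fin prodr_ge0.
- by rewrite lee_fin.
apply: eq_integral => x _; rewrite big_ord_recl EFinM tnth0.
by under eq_bigr do rewrite tnthS.
Qed.

Lemma integral_gauss_noise_tnth (n : nat) (j : 'I_n) (g : R -> R) :
  measurable_fun setT g -> (forall x, 0 <= g x) ->
  (\int[gauss_noise R n]_x (g (tnth x j))%:E = \int[N01]_a (g a)%:E)%E.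
Proof.
move=> mg g0.
pose h i : R -> R := if i == j then g else cst 1.
have mh i : measurable_fun setT (h i) by rewrite /h; case: ifP.
have h0 i x : 0 <= h i x by rewrite /h; case: ifP.
transitivity (\int[gauss_noise R n]_x (\prod_(i < n) h i (tnth x i))%:E)%E.
  apply: eq_integral => x _; rewrite (bigD1 j)//= {1}/h eqxx big1 ?mulr1//.
  by move=> i /negbTE; rewrite /h => ->.
rewrite integral_gauss_noise_prod// (bigD1 j)//= {1}/h eqxx big1 ?mule1//.
move=> i /negbTE; rewrite /h => ->.
transitivity (\int[N01]_(a in setT) cst 1%E a)%E => //.
by rewrite integral_cst// mul1e; exact: (@probability_setT _ _ _ N01).
Qed.

Definition shift_tuple (n : nat) (c : 'I_n -> R) (x : n.-tuple R) : n.-tuple R :=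
  [tuple tnth x j + c j | j < n].

Lemma measurable_shift_tuple (n : nat) (c : 'I_n -> R) :
  measurable_fun setT (shift_tuple c).
Proof.
apply/measurable_fun_tnthP => j.
rewrite (_ : _ \o _ = fun x => tnth x j + c j).
  by apply: measurable_funD => //; exact: measurable_tnth.
by apply/funext => x /=; rewrite tnth_mktuple.
Qed.

(** Cameron-Martin in dimension n, by induction: Tonelli splits off the first coordinate, the others
    are shifted inside [F], and the one-dimensional case shifts the first. *)
Lemma integral_gauss_noise_shift (n : nat) (c : 'I_n -> R) (f : n.-tuple R -> \bar R) :
  measurable_fun setT f -> (forall x, 0 <= f x)%E ->
  (\int[gauss_noise R n]_x f (shift_tuple c x) =
   \int[gauss_noise R n]_x
     (f x * (\prod_(j < n) expR (c j * tnth x j - c j ^+ 2 / 2))%:E))%E.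
Proof.
elim: n c f => [|n IH] c f mf f0.
  apply: eq_integral => x _; rewrite big_ord0 mule1.
  by congr f; apply: eq_from_tnth => -[].
have mE (a b : R) : measurable_fun setT (fun x : R => expR (a * x - b)).
  apply: measurableT_comp => //; apply: measurable_funB => //.
have mP m (c' : 'I_m -> R) : measurable_fun setT
    (fun x => \prod_(j < m) expR (c' j * tnth x j - c' j ^+ 2 / 2)).
  by apply: (@measurable_prod_tnth _ (fun j t => expR (c' j * t - c' j ^+ 2 / 2))).
have P0 m (c' : 'I_m -> R) (x : m.-tuple R) :
    0 <= \prod_(j < m) expR (c' j * tnth x j - c' j ^+ 2 / 2).
  by rewrite prodr_ge0// => j _; rewrite expR_ge0.
rewrite ge0_integral_gauss_noiseS//; last first.
  exact: (measurableT_comp mf (measurable_shift_tuple c)).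
rewrite [RHS]ge0_integral_gauss_noiseS; last 2 first.
- by apply: emeasurable_funM => //; apply/measurable_EFinP; exact: mP.
- by move=> x; rewrite mule_ge0// lee_fin.
pose c' (j : 'I_n) := c (lift ord0 j).
pose F (a : R) := (\int[gauss_noise R n]_x (f (cons_pair (a, x)) *
   (\prod_(j < n) expR (c' j * tnth x j - c' j ^+ 2 / 2))%:E))%E.
transitivity (\int[N01]_a F (a + c ord0)%R)%E.
  apply: eq_integral => a _; rewrite /F -IH//; last exact: measurable_fun_cons.
  apply: eq_integral => x _; congr f; apply: eq_from_tnth => i.
  rewrite tnth_mktuple.
  by case: (unliftP ord0 i) => [j|] ->; rewrite ?tnthS ?tnth0 ?tnth_mktuple.
have mF : measurable_fun setT F.
  apply: (@measurable_fun_fubini_tonelli_F _ _ _ _ _ (gauss_noise R n)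
    (fun p : R * n.-tuple R => (f (cons_pair p) *
   (\prod_(j < n) expR (c' j * tnth p.2 j - c' j ^+ 2 / 2))%:E)%E)).
    apply: emeasurable_funM.
      by apply: (measurableT_comp mf); exact: measurable_cons_pair.
    by apply/measurable_EFinP; apply: (measurableT_comp (mP _ _)).
  by move=> x; rewrite mule_ge0// lee_fin.
have F0 a : (0 <= F a)%E.
  by apply: integral_ge0 => x _; rewrite mule_ge0// lee_fin.
rewrite integral_normal_shift//.
apply: eq_integral => a _; rewrite /F.
have mH : measurable_fun setT (fun x : n.-tuple R => (f (cons_pair (a, x)) *
   (\prod_(j < n) expR (c' j * tnth x j - c' j ^+ 2 / 2))%:E)%E).
  apply: emeasurable_funM; first exact: measurable_fun_cons.
  by apply/measurable_EFinP; exact: mP.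
rewrite -ge0_integralZr//; last by move=> x _; rewrite mule_ge0// lee_fin.
apply: eq_integral => x _; rewrite -muleA -EFinM big_ord_recl mulrC.
by congr (_ * (_ * _)%:E)%E; apply: eq_bigr => j _; rewrite tnthS.
Qed.

End gaussian_noise.

(** * Constrained risk inequality *)

Section lower_bound.
Context {R : realType}.
Variables (sigma : R) (d : nat).
Hypothesis sigma0 : 0 < sigma.
Implicit Types (theta : d.-tuple R) (T : estimator R d).

Lemma riskE T theta :
  risk sigma T theta = (\int[gauss_noise R d]_x
    ((T (observe sigma theta x) - Lsum theta) ^+ 2)%:E)%E.
Proof.
rewrite /risk unlock /obs_law ge0_integral_distribution//.
  apply/measurable_EFinP; apply: measurable_funX.
  exact: measurable_funB.
by move=> y; rewrite lee_fin sqr_ge0.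
Qed.

Lemma risk_ge0 T theta : (0 <= risk sigma T theta)%E.
Proof. by rewrite riskE; apply: integral_ge0 => x _; rewrite lee_fin sqr_ge0. Qed.

(** The density of N(b, I) with respect to N(0, I). *)
Definition likelihood (b : 'I_d -> R) (x : d.-tuple R) : R :=
  \prod_(j < d) expR (b j * tnth x j - b j ^+ 2 / 2).

Lemma likelihood_ge0 b x : 0 <= likelihood b x.
Proof. by apply: prodr_ge0 => j _; exact: expR_ge0. Qed.

Lemma measurable_likelihood b : measurable_fun setT (likelihood b).
Proof.
apply: (@measurable_prod_tnth _ _ (fun j t => expR (b j * t - b j ^+ 2 / 2))) => j.
by apply: measurableT_comp => //; exact: measurable_funB.
Qed.

Lemma integral_likelihood b :
  (\int[gauss_noise R d]_x (likelihood b x)%:E = 1)%E.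
Proof.
transitivity (\int[gauss_noise R d]_(x in setT) cst 1%E x)%E; last first.
  by rewrite integral_cst// mul1e; exact: (@probability_setT _ _ _ (gauss_noise R d)).
have /esym := @integral_gauss_noise_shift R d b (cst 1%E) (measurable_cst _) (fun=> lee01).
by apply: etrans; apply: eq_integral => x _; rewrite mul1e.
Qed.

(** Completing the square in each coordinate; the cross terms give the chi-square exponent. *)
Lemma likelihoodM b b' x : likelihood b x * likelihood b' x =
  expR (\sum_(j < d) b j * b' j) * likelihood (fun j => b j + b' j) x.
Proof.
rewrite /likelihood -big_split/= expR_sum -big_split/=.
by apply: eq_bigr => j _; rewrite -!expRD; congr expR; field.
Qed.

Lemma integral_likelihoodM b b' :
  (\int[gauss_noise R d]_x (likelihood b x * likelihood b' x)%:E =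
   (expR (\sum_(j < d) b j * b' j))%:E)%E.
Proof.
under eq_integral do rewrite likelihoodM EFinM.
rewrite ge0_integralZl//= ?integral_likelihood ?mule1//.
- by apply/measurable_EFinP; exact: measurable_likelihood.
- by move=> x _; rewrite lee_fin likelihood_ge0.
Qed.

Definition zero_tuple : d.-tuple R := [tuple 0 | _ < d].

Lemma Lsum_zero : Lsum zero_tuple = 0.
Proof. by rewrite /Lsum big1// => i _; rewrite tnth_mktuple. Qed.

(** Changing measure to theta = 0 puts the risks at all parameters under one law, so that they can
    be averaged pointwise. *)
Lemma risk_likelihood T theta :
  risk sigma T theta = (\int[gauss_noise R d]_x
    ((T (observe sigma zero_tuple x) - Lsum theta) ^+ 2 *
      likelihood (fun j => tnth theta j / sigma) x)%:E)%E.
Proof.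
rewrite riskE.
under [RHS]eq_integral do rewrite EFinM.
pose f (x : d.-tuple R) := ((T (observe sigma zero_tuple x) - Lsum theta) ^+ 2)%:E.
rewrite -(@integral_gauss_noise_shift _ _ _ f)//.
- apply: eq_integral => x _; rewrite /f; congr ((T _ - _) ^+ 2)%:E.
  apply: eq_from_tnth => j; rewrite !tnth_mktuple add0r mulrDr addrC.
  by rewrite mulrCA divff ?mulr1// gt_eqF.
- apply/measurable_EFinP; apply: measurable_funX; apply: measurable_funB => //.
  by apply: measurableT_comp => //; exact: measurable_observe.
- by move=> x; rewrite lee_fin sqr_ge0.
Qed.

(* Pointwise, M (T - c)^2 + l T^2 + c^2 M^2 / l >= c^2 M, since the difference
   is M T^2 + (l T - c M)^2 / l; integrating with l = 2 K gives the bound. *)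
Lemma mixture_risk_bound (I : finType) (theta : I -> d.-tuple R) (c rho rho0 K : R) T :
  (0 < #|I|)%N -> 0 < K -> (forall i, Lsum (theta i) = c) ->
  (forall i, risk sigma T (theta i) <= rho%:E)%E ->
  (risk sigma T zero_tuple <= rho0%:E)%E ->
  \sum_(i : I) \sum_(i' : I) expR (\sum_(j < d)
    (tnth (theta i) j / sigma) * (tnth (theta i') j / sigma)) <= K * #|I|%:R ^+ 2 ->
  c ^+ 2 / 2 <= rho + 2 * K * rho0.
Proof.
move=> I0 K0 Lc risk_i risk_0 chi2.
have n0 : 0 < #|I|%:R :> R by rewrite ltr0n.
set n : R := #|I|%:R in chi2 n0.
pose L i := likelihood (fun j => tnth (theta i) j / sigma).
(* [M] is the likelihood ratio of the uniform mixture of the [theta i] against 0; [S] is the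
   estimator as seen under theta = 0. *)
pose M x := n^-1 * \sum_i L i x.
pose S x := T (observe sigma zero_tuple x).
have mS : measurable_fun setT S.
  by apply: measurableT_comp => //; exact: measurable_observe.
have mL i : measurable_fun setT (L i) by exact: measurable_likelihood.
have mM : measurable_fun setT M.
  by apply: measurable_funM => //; exact: measurable_sum.
have L0 i x : 0 <= L i x by exact: likelihood_ge0.
have M0 x : 0 <= M x by rewrite mulr_ge0 ?invr_ge0 ?sumr_ge0// ltW.
have eS0 : (\int[gauss_noise R d]_x (S x ^+ 2)%:E <= rho0%:E)%E.
  move: risk_0; rewrite riskE; apply: le_trans.
  by rewrite le_eqVlt; apply/orP; left; apply/eqP; apply: eq_integral => x _;
    rewrite Lsum_zero subr0.
have eS : (\int[gauss_noise R d]_x (M x * (S x - c) ^+ 2)%:E <= rho%:E)%E.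
  rewrite (_ : (fun x => _) = fun x =>
     (n^-1%:E * \sum_i ((S x - c) ^+ 2 * L i x)%:E)%E); last first.
    apply/funext => x; rewrite sumEFin -EFinM; congr EFin.
    by rewrite -mulr_sumr /M; ring.
  rewrite ge0_integralZl//; last 3 first.
  - apply: emeasurable_sum => i; apply/measurable_EFinP/measurable_funM => //.
    by apply: measurable_funX; exact: measurable_funB.
  - by move=> x _; apply: sume_ge0 => i _; rewrite lee_fin mulr_ge0 ?sqr_ge0.
  - by rewrite lee_fin invr_ge0 ltW.
  rewrite ge0_integral_sum//; last 2 first.
  - move=> i; apply/measurable_EFinP/measurable_funM => //.
    by apply: measurable_funX; exact: measurable_funB.
  - by move=> i x _; rewrite lee_fin mulr_ge0 ?sqr_ge0.
  rewrite lee_pdivrMl//.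
  apply: (@le_trans _ _ (\sum_(i : I) rho%:E)%E); last first.
    by rewrite sumEFin sumr_const lee_fin -[in leLHS]mulr_natl.
  apply: lee_sum => i _; apply: le_trans (risk_i i).
  by rewrite risk_likelihood Lc.
have eM : (\int[gauss_noise R d]_x (M x)%:E = 1)%E.
  under eq_integral do rewrite EFinM -sumEFin.
  rewrite ge0_integralZl//; last 3 first.
  - by apply: emeasurable_sum => i; exact/measurable_EFinP.
  - by move=> x _; apply: sume_ge0 => i _; rewrite lee_fin.
  - by rewrite lee_fin invr_ge0 ltW.
  rewrite ge0_integral_sum//; last 2 first.
  - by move=> i; exact/measurable_EFinP.
  - by move=> i x _; rewrite lee_fin.
  under eq_bigr do rewrite integral_likelihood.
  rewrite sumEFin sumr_const -EFinM; congr EFin.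
  by rewrite -/n mulVf// gt_eqF.
have eM2 : (\int[gauss_noise R d]_x (M x ^+ 2)%:E <= K%:E)%E.
  rewrite (_ : (fun x => _) = fun x =>
     ((n ^+ 2)^-1%:E * \sum_i \sum_i' (L i x * L i' x)%:E)%E); last first.
    apply/funext => x.
    under eq_bigr do rewrite sumEFin.
    rewrite sumEFin -EFinM; congr EFin.
    rewrite exprMn exprVn [X in _ * X]expr2 mulr_suml; congr (_ * _).
    by apply: eq_bigr => i _; rewrite mulr_sumr.
  rewrite ge0_integralZl//; last 3 first.
  - apply: emeasurable_sum => i; apply: emeasurable_sum => i'.
    exact/measurable_EFinP/measurable_funM.
  - move=> x _; apply: sume_ge0 => i _; apply: sume_ge0 => i' _.
    by rewrite lee_fin mulr_ge0.
  - by rewrite lee_fin invr_ge0 exprn_ge0// ltW.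
  rewrite ge0_integral_sum//; last 2 first.
  - by move=> i; apply: emeasurable_sum => i'; exact/measurable_EFinP/measurable_funM.
  - by move=> i x _; apply: sume_ge0 => i' _; rewrite lee_fin mulr_ge0.
  rewrite lee_pdivrMl ?exprn_gt0//.
  rewrite (eq_bigr (fun i => (\sum_i' expR (\sum_(j < d)
    (tnth (theta i) j / sigma) * (tnth (theta i') j / sigma)))%:E)).
    by rewrite sumEFin -EFinM lee_fin mulrC.
  move=> i _; rewrite ge0_integral_sum//; last 2 first.
  - by move=> i'; exact/measurable_EFinP/measurable_funM.
  - by move=> i' x _; rewrite lee_fin mulr_ge0.
  by rewrite -sumEFin; apply: eq_bigr => i' _; rewrite integral_likelihoodM.
have key x : c ^+ 2 * M x <= M x * (S x - c) ^+ 2 + 2 * K * S x ^+ 2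
     + c ^+ 2 / (2 * K) * M x ^+ 2.
  rewrite -subr_ge0.
  rewrite (_ : _ - _ = M x * S x ^+ 2 + (2 * K * S x - c * M x) ^+ 2 / (2 * K)).
    apply: addr_ge0; first by rewrite mulr_ge0 ?sqr_ge0.
    by apply: divr_ge0; rewrite ?sqr_ge0// mulr_ge0// ltW.
  by field; rewrite gt_eqF.
have mSc : measurable_fun setT (fun x => (M x * (S x - c) ^+ 2)%:E).
  apply/measurable_EFinP/measurable_funM => //.
  by apply: measurable_funX; exact: measurable_funB.
have mS2 : measurable_fun setT (fun x => (S x ^+ 2)%:E).
  by apply/measurable_EFinP; exact: measurable_funX.
have mM2 : measurable_fun setT (fun x => (M x ^+ 2)%:E).
  by apply/measurable_EFinP; exact: measurable_funX.
have K20 : 0 <= 2 * K by rewrite mulr_ge0// ltW.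
have cK0 : 0 <= c ^+ 2 / (2 * K) by rewrite divr_ge0// sqr_ge0.
have : ((c ^+ 2)%:E <= rho%:E + (2 * K)%:E * rho0%:E
     + (c ^+ 2 / (2 * K))%:E * K%:E)%E.
  rewrite -[leLHS]mule1 -eM -ge0_integralZl//; last 3 first.
  - exact/measurable_EFinP.
  - by move=> x _; rewrite lee_fin.
  - by rewrite lee_fin sqr_ge0.
  apply: (@le_trans _ _ (\int[gauss_noise R d]_x ((M x * (S x - c) ^+ 2)%:E +
    (2 * K)%:E * (S x ^+ 2)%:E + (c ^+ 2 / (2 * K))%:E * (M x ^+ 2)%:E))%E).
    apply: ge0_le_integral => //.
    - by move=> x _; rewrite -EFinM lee_fin mulr_ge0 ?sqr_ge0.
    - by apply: emeasurable_funM => //; exact/measurable_EFinP.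
    - apply: emeasurable_funD; last exact: emeasurable_funM.
      by apply: emeasurable_funD => //; exact: emeasurable_funM.
    - by move=> x _; rewrite -!EFinM -!EFinD lee_fin.
  have p1 x : (0 <= (M x * (S x - c) ^+ 2)%:E)%E.
    by rewrite lee_fin mulr_ge0 ?sqr_ge0.
  have p2 x : (0 <= (2 * K)%:E * (S x ^+ 2)%:E)%E.
    by rewrite -EFinM lee_fin mulr_ge0 ?sqr_ge0.
  have p3 x : (0 <= (c ^+ 2 / (2 * K))%:E * (M x ^+ 2)%:E)%E.
    by rewrite -EFinM lee_fin mulr_ge0 ?sqr_ge0.
  rewrite ge0_integralD//; last 3 first.
  - by move=> x _; rewrite adde_ge0.
  - by apply: emeasurable_funD => //; exact: emeasurable_funM.
  - exact: emeasurable_funM.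
  rewrite ge0_integralD//; last exact: emeasurable_funM.
  rewrite !ge0_integralZl//; last 2 first.
  - by move=> x _; rewrite lee_fin sqr_ge0.
  - by move=> x _; rewrite lee_fin sqr_ge0.
  by rewrite !leeD// lee_wpmul2l.
rewrite -!EFinM -!EFinD lee_fin => H.
(* The second moment term uses up half of c^2; the other half remains for the conclusion. *)
have : c ^+ 2 / (2 * K) * K = c ^+ 2 / 2 by field; rewrite gt_eqF.
by lra.
Qed.

End lower_bound.

(** * Spikes at one position in each of s disjoint blocks *)

Section block_design.
Context {R : realType}.
Variables (sigma : R) (d s m : nat).
Hypotheses (sigma0 : 0 < sigma) (smd : (s * m <= d)%N).

Lemma block_position_proof (k : 'I_s) (u : 'I_m) : (k * m + u < d)%N.
Proof.
apply: leq_trans smd; apply: (@leq_trans (k.+1 * m)).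
  by rewrite mulSn addnC ltn_add2r.
by rewrite leq_mul2r ltn_ord orbT.
Qed.

Definition block_position k u : 'I_d := Ordinal (block_position_proof k u).

Lemma block_position_inj k k' u u' :
  block_position k u = block_position k' u' -> k = k' /\ u = u'.
Proof.
move=> /(congr1 val) /= e; have m0 : (0 < m)%N by apply: leq_trans (ltn_ord u).
split; apply: val_inj => /=.
  by have := congr1 (divn^~ m) e; rewrite !divnMDl// !divn_small// !addn0.
by have := congr1 (modn^~ m) e; rewrite !modnMDl !modn_small.
Qed.

(** Taking one position per block, rather than an arbitrary s-subset, makes the positions
    independent under uniform [f], so the chi-square factors over blocks. *)
Definition block_support (f : {ffun 'I_s -> 'I_m}) : {set 'I_d} :=
  [set block_position k (f k) | k : 'I_s].

Definition block_vector (a : R) (f : {ffun 'I_s -> 'I_m}) : d.-tuple R :=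
  [tuple if j \in block_support f then a else 0 | j < d].

Lemma sum_block_support (f : {ffun 'I_s -> 'I_m}) (F : 'I_d -> R) :
  \sum_(j in block_support f) F j = \sum_(k < s) F (block_position k (f k)).
Proof.
rewrite big_imset/=; first by apply: eq_bigl => k.
by move=> k k' _ _ /block_position_inj[].
Qed.

Lemma mem_block_support (f : {ffun 'I_s -> 'I_m}) k u :
  (block_position k u \in block_support f) = (u == f k).
Proof.
apply/imsetP/eqP => [[k' _ /block_position_inj[-> ->]//]|->].
by exists k.
Qed.

Lemma Lsum_block_vector a f : Lsum (block_vector a f) = s%:R * a.
Proof.
rewrite /Lsum; under eq_bigr do rewrite tnth_mktuple.
by rewrite -big_mkcond/= sum_block_support sumr_const card_ord mulr_natl.
Qed.

Lemma norm0_block_vector a f : (norm0 (block_vector a f) <= s)%N.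
Proof.
apply: (@leq_trans #|block_support f|).
  apply: subset_leq_card; apply/fintype.subsetP => j; rewrite inE tnth_mktuple.
  by case: ifP => //; rewrite eqxx.
by rewrite (leq_trans (leq_imset_card _ _))// card_ord.
Qed.

Lemma block_vector_dot (b : R) (f g : {ffun 'I_s -> 'I_m}) :
  \sum_(j < d) (tnth (block_vector (sigma * b) f) j / sigma) *
    (tnth (block_vector (sigma * b) g) j / sigma) =
  \sum_(k < s) (if f k == g k then b ^+ 2 else 0).
Proof.
have E (h : {ffun 'I_s -> 'I_m}) j : tnth (block_vector (sigma * b) h) j / sigma =
    if j \in block_support h then b else 0.
  rewrite tnth_mktuple; case: ifP => _; last by rewrite mul0r.
  by rewrite mulrAC divff ?mul1r// gt_eqF.
under eq_bigr do rewrite !E.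
transitivity (\sum_(j in block_support f)
    (if j \in block_support g then b ^+ 2 else 0)).
  rewrite [RHS]big_mkcond/=; apply: eq_bigr => j _.
  by case: ifP => _; case: ifP => _; rewrite ?mulr0 ?mul0r ?expr2.
by rewrite sum_block_support; under eq_bigr do rewrite mem_block_support.
Qed.

(** For fixed [f] the sum over [g] distributes into a product over blocks. In each block one
    position agrees with [f], contributing exp(b^2), and the other m - 1 contribute 1. *)
Lemma block_chi2 (b : R) :
  \sum_(f : {ffun 'I_s -> 'I_m}) \sum_(g : {ffun 'I_s -> 'I_m})
    expR (\sum_(k < s) (if f k == g k then b ^+ 2 else 0)) =
  (m%:R * (m%:R - 1 + expR (b ^+ 2))) ^+ s.
Proof.
transitivity (\sum_(f : {ffun 'I_s -> 'I_m}) (m%:R - 1 + expR (b ^+ 2)) ^+ s).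
  apply: eq_bigr => f _.
  under eq_bigr do rewrite expR_sum.
  rewrite -(bigA_distr_bigA (fun k v => expR (if f k == v then b ^+ 2 else 0)))/=.
  transitivity (\prod_(k < s) (m%:R - 1 + expR (b ^+ 2))); last first.
    by rewrite prodr_const card_ord.
  apply: eq_bigr => k _.
  rewrite (bigD1 (f k))//= eqxx addrC; congr (_ + _).
  rewrite (eq_bigr (fun=> 1)); last first.
    by move=> v /negbTE; rewrite eq_sym => ->; rewrite expR0.
  rewrite sumr_const cardC1 card_ord -subn1 natrB//.
  by apply: leq_trans (ltn_ord (f k)).
by rewrite sumr_const card_ffun !card_ord -[LHS]mulr_natl natrX exprMn.
Qed.

End block_design.

(** Spikes of height sigma sqrt(ln E) give the mixture a second moment (1 + (E - 1) / m)^s, which is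
    at most exp(s (E - 1) / m). *)
Lemma sparse_risk_lower_bound {R : realType} (sigma : R) (d s m : nat) (E rho rho0 : R)
    (T : estimator R d) :
  0 < sigma -> (0 < m)%N -> (s * m <= d)%N -> 1 <= E ->
  (forall theta, Theta s theta -> risk sigma T theta <= rho%:E)%E ->
  (risk sigma T (zero_tuple d) <= rho0%:E)%E ->
  sigma ^+ 2 * s%:R ^+ 2 * ln E / 2 <=
    rho + 2 * expR (s%:R * ((E - 1) / m%:R)) * rho0.
Proof.
move=> sigma0 m0 smd E1 risk_s risk_0.
have E0 : 0 < E by rewrite (lt_le_trans ltr01).
have mR : 0 < m%:R :> R by rewrite ltr0n.
pose b := Num.sqrt (ln E).
have b2 : b ^+ 2 = ln E by rewrite sqr_sqrtr// ln_ge0.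
have rho00 : 0 <= rho0 by rewrite -lee_fin (le_trans _ risk_0)// risk_ge0.
pose K := (1 + (E - 1) / m%:R) ^+ s.
have K0 : 0 < K.
  by rewrite exprn_gt0// ltr_wpDr// divr_ge0 ?subr_ge0// ltW.
have := @mixture_risk_bound R sigma d sigma0 _ (block_vector smd (sigma * b))
  (s%:R * (sigma * b)) rho rho0 K T.
have -> : (s%:R * (sigma * b)) ^+ 2 / 2 = sigma ^+ 2 * s%:R ^+ 2 * ln E / 2.
  by rewrite -b2; ring.
move=> /(_ _ K0 _ _ risk_0) H; apply: le_trans (H _ _ _ _) _.
- by rewrite card_ffun !card_ord expn_gt0 m0.
- by move=> f; exact: Lsum_block_vector.
- by move=> f; apply: risk_s; exact: norm0_block_vector.
- under eq_bigr do under eq_bigr do rewrite block_vector_dot//.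
  rewrite block_chi2 card_ffun !card_ord b2 lnK ?posrE// natrX -exprAC -exprMn.
  rewrite le_eqVlt; apply/orP; left; apply/eqP; congr (_ ^+ s).
  by field; rewrite gt_eqF.
rewrite lerD2l ler_wpM2r// ler_wpM2l// /K expRM_natl.
rewrite lerXn2r ?nnegrE ?expR_ge0 ?expR_ge1Dx//.
by rewrite addr_ge0// divr_ge0 ?subr_ge0// ltW.
Qed.

(** * Optimality *)

Section optimality.
Context {R : realType}.

(** Concavity of [ln] between 1 and 1 + x, with ln 1 = 0. *)
Lemma ln1Dx_concave (l x : R) : 0 <= l <= 1 -> 0 <= x ->
  l * ln (1 + x) <= ln (1 + l * x).
Proof.
move=> /andP[l0 l1] x0.
have [i0 i1] : 0 <= 1 - l /\ 1 - l <= 1 by split; lra.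
have := @concave_ln R (Itv01 i0 i1) 1 (1 + x) ltr01.
rewrite !convRE /= ln1 /unstable.onem mulr0 add0r mulr1 subKr.
rewrite (_ : 1 - l + l * (1 + x) = 1 + l * x); last by ring.
by apply; lra.
Qed.

Lemma max_risk_le (sigma B : R) (d s : nat) (psi : nat -> R) (T : estimator R d)
    theta :
  (max_risk sigma psi T <= B%:E)%E -> (1 <= s <= d)%N -> 0 < psi s ->
  Theta s theta -> (risk sigma T theta <= (B * psi s)%:E)%E.
Proof.
move=> + /andP[s1 sd] psi0 th; rewrite /max_risk => H.
have : (ereal_sup [set risk sigma T t * (psi s)^-1%:E | t in Theta s] <= B%:E)%E.
  apply: le_trans H.
  apply: (@le_bigmax_seq _ _ _ (index_iota 1 d.+1) _ s xpredT (fun s =>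
    ereal_sup [set risk sigma T t * (psi s)^-1%:E | t in Theta s])%E) => //.
  by rewrite mem_index_iota s1 ltnS.
move=> {}H; rewrite EFinM -lee_pdivrMr// (le_trans _ H)//.
by apply: ereal_sup_ubound; exists theta.
Qed.

Lemma min_upto_attained (d : nat) (f : nat -> R) : (1 <= d)%N ->
  exists2 s, (1 <= s <= d)%N & min_upto d f = f s.
Proof.
move=> d1; rewrite /min_upto big_nat.
apply: (big_ind (fun x => exists2 s, (1 <= s <= d)%N & x = f s)).
- by exists 1%N.
- by move=> _ _ [s hs ->] [t ht ->]; rewrite /Order.min; case: ifP => _;
    [exists s|exists t].
- by move=> i hi; exists i.
Qed.

Lemma PhiL_gt0 (sigma : R) (d s : nat) : 0 < sigma -> (2 <= d)%N ->
  (1 <= s <= d)%N -> 0 < PhiL sigma d s.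
Proof.
move=> sigma0 d2 /andP[s1 _]; rewrite /PhiL.
have s0 : 0 < s%:R :> R by rewrite ltr0n.
have L0 : 0 < ln d%:R :> R by rewrite ln_gt0// ltr1n.
have d0 : 0 < d%:R :> R by rewrite ltr0n; apply: leq_trans d2.
rewrite mulr_gt0 ?mulr_gt0 ?exprn_gt0// ln_gt0// ltrDl divr_gt0 ?mulr_gt0//.
Qed.

(** With U and S as squared sparsities this is monotonicity of the rate in s; it is concavity with l
    = U / S at the point D / U. *)
Lemma PhiL_mono (D S U : R) : 0 < U -> U <= S -> 0 <= D ->
  U * ln (1 + D / U) <= S * ln (1 + D / S).
Proof.
move=> U0 US D0; have S0 : 0 < S := lt_le_trans U0 US.
have h1 : 0 <= U / S <= 1.
  by rewrite ler_pdivrMr// mul1r US andbT divr_ge0// ltW.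
have h2 : 0 <= D / U by rewrite divr_ge0// ltW.
have := ln1Dx_concave h1 h2.
rewrite (_ : U / S * (D / U) = D / S); last by field; rewrite !gt_eqF.
rewrite mulrAC ler_pdivrMr// => H.
by rewrite [leRHS]mulrC.
Qed.

(** * Consequences at fixed d and s, where [p] and [q] stand for Psi'(s) and Psi'(1) *)

Section fixed_dimension.
Variables (sigma B p q : R) (d s : nat) (T : estimator R d).
Hypotheses (sigma0 : 0 < sigma) (B0 : 0 < B) (s1d : (1 <= s <= d)%N).
Hypothesis L4 : 4 <= ln d%:R :> R.
Hypothesis risk_s :
  (forall theta, Theta s theta -> risk sigma T theta <= (B * p)%:E)%E.
Hypothesis risk_0 : (risk sigma T (zero_tuple d) <= (B * q)%:E)%E.

Let L : R := ln d%:R.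
Let S : R := s%:R ^+ 2.
(** The factor 1 + 2 V when V = e and the same risk bound serves on Theta_s and at 0. *)
Let A : R := 1 + 2 * expR 1.
Let m := (d %/ s)%N.

Let s0 : (0 < s)%N. Proof. by case/andP: s1d. Qed.
Let sR0 : 0 < s%:R :> R. Proof. by rewrite ltr0n. Qed.
Let S0 : 0 < S. Proof. by rewrite exprn_gt0. Qed.
Let m0 : (0 < m)%N. Proof. by rewrite divn_gt0//; case/andP: s1d. Qed.
Let mR0 : 0 < m%:R :> R. Proof. by rewrite ltr0n. Qed.
Let smd : (s * m <= d)%N. Proof. by rewrite mulnC leq_trunc_div. Qed.
Let dR0 : 0 < d%:R :> R.
Proof. by rewrite ltr0n; case/andP: s1d => /leq_trans h /h. Qed.
Let L0 : 0 < L. Proof. by apply: lt_le_trans L4. Qed.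
Let expL : expR L = d%:R. Proof. by rewrite lnK// posrE. Qed.

(** Rounding d / s down loses at most a factor 2, because s <= d. *)
Let d_le : d%:R / (2 * S) <= m%:R / s%:R.
Proof.
rewrite ler_pdivrMr ?mulr_gt0// mulrAC ler_pdivlMr// /S.
have : (d <= m * (2 * s))%N.
  rewrite {1}(divn_eq d s) mulnCA mul2n -addnn leq_add2l.
  by rewrite (leq_trans (ltnW (ltn_pmod _ s0)))// leq_pmull.
rewrite -(ler_nat R) !natrM => H.
rewrite [leRHS](_ : _ = m%:R * (2 * s%:R) * s%:R); last by ring.
by rewrite ler_wpM2r// ltW.
Qed.

Let risk_zero_s : (risk sigma T (zero_tuple d) <= (B * p)%:E)%E.
Proof.
apply: risk_s; rewrite /Theta /= /norm0 (eq_card0 _)// => j.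
by rewrite inE tnth_mktuple eqxx.
Qed.

(** The choice E = 1 + m / s makes V = e, and the risk at 0 is also at most B p because 0 lies in
    Theta_s. *)
Lemma minimax_lower_bound :
  sigma ^+ 2 * S * ln (1 + d%:R / (2 * S)) <= 2 * A * B * p.
Proof.
have := @sparse_risk_lower_bound R sigma d s m (1 + m%:R / s%:R) _ _ T
  sigma0 m0 smd _ risk_s risk_zero_s.
have q0 : 0 <= m%:R / s%:R :> R by rewrite divr_ge0.
rewrite lerDl => /(_ q0).
rewrite (_ : s%:R * _ = 1); last by field; rewrite !gt_eqF.
rewrite -/S => H.
have h : ln (1 + d%:R / (2 * S)) <= ln (1 + m%:R / s%:R).
  by rewrite ler_ln ?posrE ?lerD2l// ltr_pwDl// divr_ge0// mulr_ge0// ltW.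
have g : 0 <= sigma ^+ 2 * S by rewrite mulr_ge0 ?ltW// exprn_gt0.
have := ler_wpM2l g h; rewrite /A; lra.
Qed.

(** Concavity with l = 1 / (2 L) trades d L / S for d / (2 S) at the cost of a factor 2 L. *)
Lemma ratio_ge_invL : PhiL sigma d s <= 4 * A * B * L * p.
Proof.
have g1 : 0 <= (2 * L)^-1 <= 1.
  rewrite invr_ge0 mulr_ge0//=; last exact: ltW.
  by rewrite invf_le1 ?mulr_gt0//; have := L4; rewrite -/L; lra.
have g2 : 0 <= d%:R * L / S by rewrite divr_ge0 ?mulr_ge0// ltW.
have := ln1Dx_concave g1 g2.
rewrite (_ : _ * (_ / S) = d%:R / (2 * S)); last by field; rewrite !gt_eqF.
rewrite mulrC ler_pdivrMr ?mulr_gt0// => H.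
have := minimax_lower_bound; rewrite /PhiL -/S -/L => H1.
have g : 0 <= sigma ^+ 2 * S by rewrite mulr_ge0 ?ltW// exprn_gt0.
have := ler_wpM2l g H; have := ler_wpM2l (ltW L0) H1; lra.
Qed.

Let ln1DdL : ln (1 + d%:R * L) <= 2 * L.
Proof.
have dL : L <= d%:R - 1 by have := expR_ge1Dx L; rewrite expL; lra.
rewrite (_ : 2 * L = ln (d%:R ^+ 2)); last by rewrite lnXn// mulr_natl.
rewrite ler_ln ?posrE ?exprn_gt0//.
  by have : 0 < d%:R :> R by []; have : 1 <= d%:R :> R;
    [have := L0; lra | nra].
by rewrite ltr_pwDl// mulr_ge0// ltW.
Qed.

(** For s below d^(1/4) the logarithm in the rate is at most 2 L and the one in
    [minimax_lower_bound] at least L / 4, so the ratio stays bounded away from 0. *)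
Lemma sparse_ratio : S < expR (L / 2) ->
  PhiL sigma d s <= 16 * A * B * p.
Proof.
move=> SL.
have eL : expR (L / 2) = expR (L / 4) ^+ 2.
  by rewrite -expRM_natl; congr expR; field.
have eL4 : 2 <= expR (L / 4).
  by have := expR_ge1Dx (L / 4); have := L4; rewrite -/L; lra.
have h1 : L / 4 <= ln (1 + d%:R / (2 * S)).
  rewrite -[leLHS]expRK ler_ln ?posrE ?expR_gt0//; last first.
    by rewrite ltr_pwDl// divr_ge0// mulr_ge0// ltW.
  apply: (@le_trans _ _ (expR (L / 2) / 2)); first by rewrite eL; nra.
  rewrite ler_wpDl// ler_pdivlMr ?mulr_gt0//.
  rewrite -expL [in leRHS](_ : L = L / 2 + L / 2); last by field.
  have := expR_gt0 (L / 2); rewrite expRD; nra.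
have h2 : ln (1 + d%:R * L / S) <= 2 * L.
  apply: le_trans ln1DdL.
  rewrite ler_ln ?posrE; last 2 first.
  - by rewrite ltr_pwDl// divr_ge0 ?mulr_ge0// ltW.
  - by rewrite ltr_pwDl// mulr_ge0// ltW.
  rewrite lerD2l ler_pdivrMr//; apply: ler_peMr.
    by rewrite mulr_ge0// ltW.
  by rewrite /S exprn_ege1// ler1n.
have := minimax_lower_bound; rewrite /PhiL -/S -/L => H1.
have g : 0 <= sigma ^+ 2 * S by rewrite mulr_ge0 ?ltW// exprn_gt0.
have := ler_wpM2l g h1; have := ler_wpM2l g h2; lra.
Qed.

(** Monotonicity reduces to squared sparsity sqrt d, where 1 + d L / sqrt d exceeds sqrt d. *)
Lemma dense_PhiL : expR (L / 2) <= S ->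
  sigma ^+ 2 * (expR (L / 2) * (L / 2)) <= PhiL sigma d s.
Proof.
move=> SL; rewrite /PhiL -/S -/L -mulrA.
apply: ler_wpM2l; first by rewrite exprn_ge0// ltW.
have D0 : 0 <= d%:R * L by rewrite mulr_ge0// ltW.
apply: (le_trans _ (PhiL_mono (expR_gt0 _) SL D0)).
rewrite ler_wpM2l ?expR_ge0// -[leLHS]expRK ler_ln ?posrE ?expR_gt0//; last first.
  by rewrite ltr_pwDl// divr_ge0 ?expR_ge0 ?mulr_ge0// ltW.
rewrite ler_wpDl// ler_pdivlMr ?expR_gt0// -expRD -splitr expL ler_peMr ?ltW//.
by have := L4; rewrite -/L; lra.
Qed.

(** With E - 1 = (m / s) L / 4 one has V = d^(1/4), and the spike term is at least PhiL / 16. The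
    risk on Theta_s covers at most half of that, so the risk at 0 must cover the rest. *)
Lemma superefficiency_cost : B * p <= PhiL sigma d s / 32 ->
  PhiL sigma d s <= 64 * B * expR (L / 4) * q.
Proof.
move=> small.
pose x := m%:R * (L / 4) / s%:R.
have x0 : 0 <= x by rewrite !mulr_ge0// ?invr_ge0// ltW.
have := @sparse_risk_lower_bound R sigma d s m (1 + x) _ _ T
  sigma0 m0 smd _ risk_s risk_0.
rewrite lerDl => /(_ x0).
rewrite (_ : s%:R * _ = L / 4); last by rewrite /x; field; rewrite !gt_eqF.
rewrite -/S => H.
have h : 1 / 8 * ln (1 + d%:R * L / S) <= ln (1 + x).
  apply: (@le_trans _ _ (ln (1 + 1 / 8 * (d%:R * L / S)))).
    by apply: ln1Dx_concave; [lra|rewrite divr_ge0 ?mulr_ge0// ltW].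
  have h8 : 1 / 8 * (d%:R * L / S) <= x.
    rewrite [leLHS](_ : _ = d%:R / (2 * S) * (L / 4)); last by field; rewrite gt_eqF.
    rewrite [leRHS](_ : _ = m%:R / s%:R * (L / 4)); last by rewrite /x; ring.
    by rewrite ler_wpM2r// divr_ge0// ltW.
  rewrite ler_ln ?posrE ?lerD2l// ltr_pwDl//.
  by rewrite mulr_ge0// divr_ge0 ?mulr_ge0// ltW.
have g : 0 <= sigma ^+ 2 * S by rewrite mulr_ge0 ?ltW// exprn_gt0.
have := ler_wpM2l g h; move: small; rewrite /PhiL -/S -/L; lra.
Qed.

(** The ratio at 1 is at least of order d^(1/4) and the ratio at s at least of order 1 / L. Since
    exp(L / 4) >= L^2 / 32, the product is at least of order L. *)
Lemma ratio_product : 0 < p -> 0 < q ->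
  p / PhiL sigma d s < (32 * B)^-1 -> p / PhiL sigma d s < (16 * A * B)^-1 ->
  L / ((32 * 32 * 32) * A * B ^+ 2) <= q / PhiL sigma d 1 * (p / PhiL sigma d s).
Proof.
move=> p0 q0 r1 r2.
have d2 : (2 <= d)%N.
  rewrite ltnNge; apply/negP => d1; have := L4.
  have -> : d = 1%N by apply/eqP; rewrite eqn_leq d1 -(ltr0n R).
  by rewrite ln1; lra.
have Phi0 : 0 < PhiL sigma d s by apply: PhiL_gt0.
have Phi10 : 0 < PhiL sigma d 1 by apply: PhiL_gt0 => //=; exact: ltnW.
have A0 : 0 < A by rewrite /A ltr_wpDr// mulr_ge0// expR_ge0.
have SL : expR (L / 2) <= S.
  rewrite leNgt; apply/negP => /sparse_ratio; apply/negP; rewrite -ltNge.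
  move: r2; rewrite ltr_pdivrMr// mulrC ltr_pdivlMr ?mulr_gt0//.
  by rewrite mulrC.
have h1 : PhiL sigma d s <= 64 * B * expR (L / 4) * q.
  apply: superefficiency_cost.
  move: r1; rewrite ltr_pdivrMr// mulrC ltr_pdivlMr ?mulr_gt0//; lra.
have h2 := dense_PhiL SL.
have h3 : PhiL sigma d 1 <= sigma ^+ 2 * (2 * L).
  rewrite /PhiL expr1n mulr1 divr1.
  by apply: ler_wpM2l => //; rewrite exprn_ge0// ltW.
have q1 : expR (L / 4) / (256 * B) <= q / PhiL sigma d 1.
  rewrite ler_pdivlMr// mulrAC ler_pdivrMr ?mulr_gt0//.
  have eL : expR (L / 2) = expR (L / 4) ^+ 2.
    by rewrite -expRM_natl; congr expR; field.
  have e0 := expR_gt0 (L / 4).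
  have h4 : sigma ^+ 2 * (expR (L / 4) * (L / 2)) <= 64 * B * q.
    rewrite -(ler_pM2l e0).
    rewrite [leRHS](_ : _ = 64 * B * expR (L / 4) * q); last by ring.
    by apply: le_trans h1; apply: le_trans h2; rewrite eL; nra.
  apply: (@le_trans _ _ (expR (L / 4) * (sigma ^+ 2 * (2 * L)))).
    by apply: ler_wpM2l h3; exact: ltW.
  by nra.
have q2 : (4 * A * B * L)^-1 <= p / PhiL sigma d s.
  rewrite ler_pdivlMr// mulrC ler_pdivrMr ?mulr_gt0//.
  by rewrite mulrC; exact: ratio_ge_invL.
apply: (le_trans _ (ler_pM _ _ q1 q2)); last 2 first.
- by rewrite divr_ge0 ?expR_ge0// mulr_ge0// ltW.
- by rewrite invr_ge0 !mulr_ge0// ltW.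
have e2 : L ^+ 2 / 32 <= expR (L / 4).
  have L40 : 0 <= L / 4 by rewrite divr_ge0// ltW.
  have := expR_ge1Dxn 1 L40.
  rewrite (_ : 2`!%:R = 2 :> R)// exprMn exprVn; lra.
rewrite -[leRHS]mulrA -invfM ler_pdivlMr ?mulr_gt0//.
rewrite [leLHS](_ : _ = L ^+ 2 / 32)//.
by field; rewrite !gt_eqF.
Qed.

End fixed_dimension.

End optimality.

Lemma near_le_ln (R : realType) (X : R) : \forall d \near \oo, X <= ln (d%:R : R).
Proof.
near=> d.
have Xd : expR X <= d%:R by near: d; exact: nbhs_infty_ger.
by rewrite -[X]expRK ler_ln ?posrE ?(lt_le_trans _ Xd) ?expR_gt0.
Unshelve. all: by end_near. Qed.

Lemma PhiL_optimality (R : realType) (sigma : R) : 0 < sigma ->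
  adaptive_optimality sigma (PhiL sigma).
Proof.
move=> sigma0 Psi' Psi'0 [C' C'0 HC'] ratio0.
exists (fun=> 1%N) => [d d2|]; first exact: ltnW.
apply/cvgryPge => X.
pose A : R := 1 + 2 * expR 1.
have A0 : 0 < A by rewrite /A ltr_wpDr// mulr_ge0// expR_ge0.
(* The infimum over estimators may not be attained; doubling its bound leaves room for an actual
   [T]. *)
pose B := 2 * C'.
have B0 : 0 < B by rewrite mulr_gt0.
have c1 : 0 < (32 * B)^-1 by rewrite invr_gt0 mulr_gt0.
have c2 : 0 < (16 * A * B)^-1 by rewrite invr_gt0 !mulr_gt0.
near=> d.
have L4 : 4 <= ln d%:R :> R.
  by near: d; exact: near_le_ln.
have LX : X <= ln d%:R / ((32 * 32 * 32) * A * B ^+ 2).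
  rewrite ler_pdivlMr; last by rewrite !mulr_gt0// exprn_gt0.
  by near: d; exact: near_le_ln.
have d2 : (2 <= d)%N by near: d; exists 2%N.
have [s s1d rE] := @min_upto_attained _ d (fun s => Psi' d s / PhiL sigma d s) (ltnW d2).
have r1 : Psi' d s / PhiL sigma d s < (32 * B)^-1.
  by rewrite -rE; near: d; move/cvgr_lt: ratio0; apply.
have r2 : Psi' d s / PhiL sigma d s < (16 * A * B)^-1.
  by rewrite -rE; near: d; move/cvgr_lt: ratio0; apply.
have /ereal_inf_lt [_ [T _ <-] HT] :
    (ereal_inf [set max_risk sigma (Psi' d) T | T in [set: estimator R d]] < B%:E)%E.
  by rewrite (le_lt_trans (HC' _ d2))// lte_fin /B; lra.
have p0 : 0 < Psi' d s by exact: Psi'0.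
have q0 : 0 < Psi' d 1%N by apply: Psi'0 => //=; exact: ltnW.
rewrite rE; apply: le_trans LX _.
apply: (@ratio_product R sigma B (Psi' d s) (Psi' d 1%N) d s T) => //.
  by move=> theta th; apply: max_risk_le th => //; exact: ltW.
apply: max_risk_le => //; [exact: ltW|exact: ltnW|].
rewrite /Theta /= /norm0 (eq_card0 _)// => j.
by rewrite inE tnth_mktuple eqxx.
Unshelve. all: by end_near. Qed.

(** * Moments of thresholded noise *)

Section mean_le.
Context d (T : measurableType d) (R : realType) (P : probability T R).
Implicit Types (f g : T -> R) (c : R).

(** Carrying measurability and nonnegativity along with the bound lets moment bounds compose without
    separate side conditions. *)
Definition mean_le f c := [/\ measurable_fun setT f, forall x, 0 <= f x &
  (\int[P]_x (f x)%:E <= c%:E)%E].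

Lemma mean_le_cst c : 0 <= c -> mean_le (cst c) c.
Proof.
move=> c0; split => //; rewrite (_ : (fun x => _) = cst c%:E)//.
by rewrite integral_cst// [X in (_ * X)%E](@probability_setT _ _ _ P) mule1.
Qed.

Lemma mean_leW f g c : mean_le f c -> measurable_fun setT g ->
  (forall x, 0 <= g x) -> (forall x, g x <= f x) -> mean_le g c.
Proof.
move=> [mf f0 fc] mg g0 gf; split => //; apply: le_trans fc.
apply: ge0_le_integral => //; try exact/measurable_EFinP.
all: by move=> x _; rewrite lee_fin.
Qed.

Lemma mean_le_trans f c c' : mean_le f c -> c <= c' -> mean_le f c'.
Proof. by move=> [mf f0 fc] cc; split => //; apply: le_trans fc _; rewrite lee_fin. Qed.

Lemma mean_leD f g c c' : mean_le f c -> mean_le g c' ->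
  mean_le (fun x => f x + g x) (c + c').
Proof.
move=> [mf f0 fc] [mg g0 gc]; split.
- exact: measurable_funD.
- by move=> x; rewrite addr_ge0.
- under eq_integral do rewrite EFinD.
  rewrite ge0_integralD//; try exact/measurable_EFinP;
    try by move=> x _; rewrite lee_fin.
  by rewrite EFinD leeD.
Qed.

Lemma mean_leZ k f c : 0 <= k -> mean_le f c -> mean_le (fun x => k * f x) (k * c).
Proof.
move=> k0 [mf f0 fc]; split.
- exact: measurable_funM.
- by move=> x; rewrite mulr_ge0.
- under eq_integral do rewrite EFinM.
  rewrite ge0_integralZl_EFin//; try exact/measurable_EFinP;
    try by move=> x _; rewrite lee_fin.
  by rewrite EFinM lee_wpmul2l// lee_fin.
Qed.

Lemma mean_le_sum (I : Type) (r : seq I) (Q : pred I) (f : I -> T -> R) (c : I -> R) :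
  (forall i, Q i -> mean_le (f i) (c i)) ->
  mean_le (fun x => \sum_(i <- r | Q i) f i x) (\sum_(i <- r | Q i) c i).
Proof.
move=> fc; elim: r => [|i r IH].
  rewrite big_nil (_ : (fun x => _) = cst 0); first exact: mean_le_cst.
  by apply/funext => x; rewrite big_nil.
rewrite big_cons (_ : (fun x => _) = fun x =>
    if Q i then f i x + \sum_(i <- r | Q i) f i x else \sum_(i <- r | Q i) f i x).
  by case: ifP => // Qi; apply: mean_leD => //; exact: fc.
by apply/funext => x; rewrite big_cons.
Qed.

End mean_le.

Section exponential_moments.
Context {R : realType}.
Local Notation N01 := (@normal_prob R 0 1).

Let sqr_abs (x : R) : `|x| ^+ 2 = x ^+ 2 := real_normK (num_real x).

(** With v = u / 2, cosh u - 1 = (exp v - exp(-v))^2 / 2, and exp v - exp(-v) = exp v (1 - exp(-u))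
    <= u exp v for u >= 0. *)
Lemma cosh_le (u : R) :
  (expR u + expR (- u)) / 2 <= 1 + u ^+ 2 * expR `|u| / 2.
Proof.
wlog u0 : u / 0 <= u => [H|].
  have [|u0] := leP 0 u; first exact: H.
  by have := H (- u); rewrite opprK sqrrN normrN oppr_ge0 addrC ltW//; apply.
rewrite ger0_norm//; pose v := u / 2.
have e1 : expR u = expR v ^+ 2 by rewrite -expRM_natl; congr expR; rewrite /v; field.
have e2 : expR (- u) = expR (- v) ^+ 2.
  by rewrite -expRM_natl; congr expR; rewrite /v; field.
have e3 := expRxMexpNx_1 v.
have : expR v - expR (- v) <= u * expR v.
  have := expR_ge1Dx (- u); rewrite e2 => h.
  have e0 := expR_gt0 v.
  have -> : expR (- v) = expR (- v) ^+ 2 * expR v.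
    by rewrite expr2 -mulrA [X in _ = _ * X]mulrC e3 mulr1.
  have := ler_wpM2r (ltW e0) h; lra.
have : 0 <= expR v - expR (- v).
  by rewrite subr_ge0 ler_expR /v; lra.
move=> h0 h1; have := ler_pM h0 h0 h1 h1; rewrite e1 e2.
have e4 : expR v * expR (- v) = 1 by [].
lra.
Qed.

Lemma sqr_le_cosh (u : R) : u ^+ 2 <= 2 * (expR u + expR (- u)).
Proof.
wlog u0 : u / 0 <= u => [H|].
  have [|u0] := leP 0 u; first exact: H.
  by have := H (- u); rewrite opprK sqrrN oppr_ge0 addrC ltW//; apply.
have := expR_ge1Dxn 1 u0; rewrite (_ : 2`!%:R = 2 :> R)//.
by have := expR_gt0 (- u); lra.
Qed.

(** As h is odd and the law symmetric, the mean of exp h equals that of cosh h. This removes the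
    linear term, and 1 + v / 2 <= exp(v / 2). *)
Lemma normal_exp_moment (h : R -> R) (v : R) :
  measurable_fun setT h -> (forall x, h (- x) = - h x) ->
  mean_le N01 (fun x => h x ^+ 2 * expR `|h x|) v ->
  mean_le N01 (fun x => expR (h x)) (expR (v / 2)).
Proof.
move=> mh hN hv.
have me : measurable_fun setT (fun x => expR (h x)) by exact: measurableT_comp.
have meN : measurable_fun setT (fun x => expR (- h x)).
  by apply: measurableT_comp => //; exact: measurableT_comp.
split=> [//|x|]; first exact: expR_ge0.
have sym : (\int[N01]_x (expR (- h x))%:E = \int[N01]_x (expR (h x))%:E)%E.
  rewrite -[RHS]integral_normalN//.
  - by apply: eq_integral => x _; rewrite hN.
  - exact/measurable_EFinP.
have : mean_le N01 (fun x => 1 + 2^-1 * (h x ^+ 2 * expR `|h x|)) (1 + 2^-1 * v).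
  apply: mean_leD; first exact: mean_le_cst.
  by apply: mean_leZ.
move/mean_leW => /(_ (fun x => 2^-1 * (expR (h x) + expR (- h x)))) [].
- by apply: measurable_funM => //; exact: measurable_funD.
- by move=> x; rewrite mulr_ge0// addr_ge0 ?expR_ge0.
- by move=> x; have := cosh_le (h x); lra.
move=> _ _.
under eq_integral do rewrite EFinM EFinD.
rewrite ge0_integralZl_EFin//;
  [|by move=> x _; rewrite adde_ge0// lee_fin expR_ge0
   |by apply: emeasurable_funD; exact/measurable_EFinP].
rewrite ge0_integralD//; try exact/measurable_EFinP;
  try by move=> x _; rewrite lee_fin expR_ge0.
rewrite sym.
set a := integral _ _ _; rewrite lee_pdivrMl//.
have : (0 <= a)%E by apply: integral_ge0 => x _; rewrite lee_fin expR_ge0.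
(* Finiteness of the moment is not known beforehand; nonnegativity and the bound itself exclude the
   infinite cases. *)
case: a => [r||]// _; rewrite -EFinM -EFinD !lee_fin => h2.
by have := expR_ge1Dx (v / 2); lra.
Qed.

(** Independence turns the moment into a product. Coordinates outside [U] contribute 1 <= exp(v /
    2), so n can replace the size of [U]. *)
Lemma noise_exp_moment (n : nat) (U : {pred 'I_n}) (h : R -> R) (v : R) :
  measurable_fun setT h -> (forall x, h (- x) = - h x) -> 0 <= v ->
  mean_le N01 (fun x => h x ^+ 2 * expR `|h x|) v ->
  mean_le (gauss_noise R n) (fun x => expR (\sum_(j | j \in U) h (tnth x j)))
    (expR (n%:R * v / 2)).
Proof.
move=> mh hN v0 hv; have [_ _ ehv] := normal_exp_moment mh hN hv.
pose g (j : 'I_n) x := if j \in U then expR (h x) else 1.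
have mg j : measurable_fun setT (g j).
  by rewrite /g; case: (j \in U) => //; exact: measurableT_comp.
have g0 j x : 0 <= g j x by rewrite /g; case: ifP => // _; exact: expR_ge0.
have E : (fun x : n.-tuple R => expR (\sum_(j | j \in U) h (tnth x j))) =
         (fun x => \prod_(j < n) g j (tnth x j)).
  by apply/funext => x; rewrite expR_sum [LHS]big_mkcond.
rewrite E; split.
- exact: measurable_prod_tnth.
- by move=> x; exact: prodr_ge0.
rewrite integral_gauss_noise_prod//.
have -> : (expR (n%:R * v / 2))%:E = (\prod_(j < n) (expR (v / 2))%:E)%E.
  by rewrite prodEFin prodr_const card_ord -mulrA expRM_natl.
suff : (0 <= \prod_(j < n) \int[N01]_a (g j a)%:E <=
    \prod_(j < n) (expR (v / 2))%:E)%E by move/andP => [].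
apply: (big_ind2 (fun x y : \bar R => 0 <= x <= y)%E) => [|x y z t|j _].
- by rewrite lexx lee01.
- move=> /andP[x0 xy] /andP[z0 zt]; rewrite mule_ge0//=.
  by rewrite lee_pmul.
- apply/andP; split.
    by apply: integral_ge0 => x _; rewrite lee_fin.
  rewrite /g; case: (j \in U) => //.
  have [_ _] := @mean_le_cst _ _ R N01 1 ler01.
  by move/le_trans; apply; rewrite lee_fin -expR0 ler_expR divr_ge0.
Qed.

Section noise_moments.
Variables (n : nat) (U : {pred 'I_n}) (h : R -> R) (l v : R).
Hypotheses (mh : measurable_fun setT h) (hN : forall x, h (- x) = - h x).
Hypotheses (v0 : 0 <= v) (l0 : 0 < l).
Hypothesis hv : mean_le N01 (fun x => (l * h x) ^+ 2 * expR `|l * h x|) v.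

Let N (x : n.-tuple R) := \sum_(j | j \in U) h (tnth x j).

Lemma measurable_noise_sum : measurable_fun setT N.
Proof.
rewrite (_ : N = fun x => \sum_(j <- enum U) h (tnth x j)).
  apply: measurable_sum => j.
  by apply: (measurableT_comp mh); exact: measurable_tnth.
by apply/funext => x; rewrite big_enum.
Qed.

Let cosh_moment : mean_le (gauss_noise R n)
  (fun x => expR (l * N x) + expR (- (l * N x))) (2 * expR (n%:R * v / 2)).
Proof.
rewrite mulr_natl mulr2n; apply: mean_leD.
  rewrite (_ : (fun x => _) = fun x => expR (\sum_(j | j \in U) l * h (tnth x j))).
    apply: (@noise_exp_moment _ _ (fun x => l * h x)) => //.
      exact: measurable_funM.
    by move=> x; rewrite hN mulrN.
  by apply/funext => x; rewrite /N mulr_sumr.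
rewrite (_ : (fun x => _) = fun x => expR (\sum_(j | j \in U) - (l * h (tnth x j)))).
  apply: (@noise_exp_moment _ _ (fun x => - (l * h x))) => //.
  - by apply: measurableT_comp => //; exact: measurable_funM.
  - by move=> x; rewrite hN mulrN.
  - by under eq_fun do rewrite sqrrN normrN.
by apply/funext => x; rewrite /N mulr_sumr sumrN.
Qed.

Lemma noise_second_moment : mean_le (gauss_noise R n) (fun x => N x ^+ 2)
  (4 / l ^+ 2 * expR (n%:R * v / 2)).
Proof.
have k0 : 0 <= 2 / l ^+ 2 by rewrite divr_ge0// exprn_ge0// ltW.
apply: (@mean_le_trans _ _ _ _ _ (2 / l ^+ 2 * (2 * expR (n%:R * v / 2)))).
  apply: (mean_leW (mean_leZ k0 cosh_moment)).
  - by apply: measurable_funX; exact: measurable_noise_sum.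
  - by move=> x; exact: sqr_ge0.
  - move=> x; rewrite mulrAC ler_pdivlMr ?exprn_gt0// mulrC -exprMn.
    exact: sqr_le_cosh.
by rewrite le_eqVlt; apply/orP; left; apply/eqP; ring.
Qed.

(** A Chernoff bound: t <= exp(t - 1) at t = |N| / w gives N^2 <= w^2 exp(2 (|N| - w) / w), and 2 /
    w <= l, so N^2 <= w^2 exp(l (|N| - w)) on the tail. *)
Lemma noise_tail_moment (w : R) : 0 < w -> 2 <= l * w ->
  mean_le (gauss_noise R n) (fun x => if w < `|N x| then N x ^+ 2 else 0)
    (2 * w ^+ 2 * expR (n%:R * v / 2 - l * w)).
Proof.
move=> w0 lw.
have k0 : 0 <= w ^+ 2 * expR (- (l * w)) by rewrite mulr_ge0 ?sqr_ge0 ?expR_ge0.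
apply: (mean_le_trans (mean_leW (mean_leZ k0 cosh_moment) _ _ _)).
- apply: measurable_fun_ifT => //; last first.
    by apply: measurable_funX; exact: measurable_noise_sum.
  apply: measurable_fun_ltr => //.
  by apply: measurableT_comp => //; exact: measurable_noise_sum.
- by move=> x; case: ifP => // _; exact: sqr_ge0.
- move=> x; case: ifP => [wN|_]; last first.
    by rewrite mulr_ge0// addr_ge0 ?expR_ge0.
  have h1 : `|N x| / w <= expR (`|N x| / w - 1).
    by have := expR_ge1Dx (`|N x| / w - 1); rewrite addrC subrK.
  have h2 : (`|N x| / w) ^+ 2 <= expR (l * (`|N x| - w)).
    apply: (@le_trans _ _ (expR (`|N x| / w - 1) ^+ 2)).
      by rewrite lerXn2r ?nnegrE ?divr_ge0 ?expR_ge0// ltW.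
    rewrite -expRM_natl ler_expR.
    rewrite (_ : _ - 1 = (`|N x| - w) / w); last by field; rewrite gt_eqF.
    rewrite mulrA ler_pdivrMr// [leRHS]mulrAC.
    by apply: ler_wpM2r => //; rewrite subr_ge0 ltW.
  have h3 : expR (l * `|N x|) <= expR (l * N x) + expR (- (l * N x)).
    case: (leP 0 (N x)) => Nx.
      by rewrite ger0_norm// lerDl expR_ge0.
    by rewrite ltr0_norm// mulrN lerDr expR_ge0.
  rewrite -mulrA -sqr_abs [leLHS](_ : _ = w ^+ 2 * (`|N x| / w) ^+ 2); last first.
    by field; rewrite gt_eqF.
  rewrite ler_wpM2l ?sqr_ge0//; apply: le_trans h2 _.
  by rewrite mulrBr expRD mulrC ler_wpM2l ?expR_ge0.
- rewrite expRD le_eqVlt; apply/orP; left; apply/eqP; ring.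
Qed.

End noise_moments.

(** * Thresholds, bands and their exponential moments *)

Definition tau (i : nat) : R := 8 * Num.sqrt i%:R.

Definition hard_threshold (i : nat) (u : R) : R := if tau i < `|u| then u else 0.

Definition band (i : nat) (u : R) : R := hard_threshold i u - hard_threshold i.+1 u.

Lemma tau_ge0 i : 0 <= tau i. Proof. by rewrite mulr_ge0. Qed.

Lemma tau_sqr i : tau i ^+ 2 = 64 * i%:R.
Proof. by rewrite exprMn sqr_sqrtr//; congr (_ * _); rewrite expr2 -natrM. Qed.

Lemma tau_le i j : (i <= j)%N -> tau i <= tau j.
Proof. by move=> ij; rewrite ler_wpM2l// ler_wsqrtr// ler_nat. Qed.

Lemma tau_lt_sqr i u : tau i < `|u| -> 64 * i%:R <= u ^+ 2.
Proof.
move=> h; rewrite -tau_sqr -[u ^+ 2]sqr_abs.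
by rewrite lerXn2r ?nnegrE ?tau_ge0// ltW.
Qed.

Lemma hard_thresholdN i u : hard_threshold i (- u) = - hard_threshold i u.
Proof. by rewrite /hard_threshold normrN; case: ifP => // _; rewrite oppr0. Qed.

Lemma bandN i u : band i (- u) = - band i u.
Proof. by rewrite /band !hard_thresholdN opprD. Qed.

Lemma measurable_hard_threshold i : measurable_fun setT (hard_threshold i).
Proof.
apply: measurable_fun_ifT => //.
by apply: measurable_fun_ltr => //; exact: measurableT_comp.
Qed.

Lemma measurable_band i : measurable_fun setT (band i).
Proof. by apply: measurable_funB; exact: measurable_hard_threshold. Qed.

Lemma band_spec i u : band i u = 0 \/
  [/\ tau i < `|u|, `|u| <= tau i.+1 & band i u = u].
Proof.
rewrite /band /hard_threshold; have := tau_le (leqnSn i).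
case: ltP => h1; case: ltP => h2 h3; [left|right|left|left].
- by rewrite subrr.
- by rewrite subr0.
- by have := lt_le_trans h2 (le_trans h1 h3); rewrite ltxx.
- by rewrite subrr.
Qed.

Lemma band_le i u : `|band i u| <= tau i.+1.
Proof.
by case: (band_spec i u) => [->|[_ h ->//]]; rewrite normr0 tau_ge0.
Qed.

Lemma hard_threshold_dist i u : `|hard_threshold i u - u| <= tau i.
Proof.
rewrite /hard_threshold; case: ltP => h; first by rewrite subrr normr0 tau_ge0.
by rewrite sub0r normrN.
Qed.

(** As [tau 0] is 0, the only value cut off is 0 itself. *)
Lemma hard_threshold0 u : hard_threshold 0 u = u.
Proof.
rewrite /hard_threshold /tau sqrtr0 mulr0.
by case: ltP => //; rewrite normr_le0 => /eqP ->.
Qed.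

Lemma mean_le_expR_sqr : mean_le N01 (fun x => expR (x ^+ 2 / 4)) 2.
Proof.
split=> [|x|]; last 1 first.
- rewrite integral_normal_expR_sqr lee_fin -[leRHS]ger0_norm// -sqrtr_sqr.
  by rewrite ler_wsqrtr// expr2 ler_peMl// ler1n.
- by apply: measurableT_comp => //; apply: measurable_funM => //; exact: measurable_funX.
- exact: expR_ge0.
Qed.

Lemma mean_le_sqr : mean_le N01 (fun x => x ^+ 2) 8.
Proof.
apply: (@mean_le_trans _ _ _ _ _ (4 * 2)); last by rewrite -natrM.
apply: (mean_leW (mean_leZ _ mean_le_expR_sqr)) => //.
- by move=> x; exact: sqr_ge0.
- by move=> x; have := expR_ge1Dx (x ^+ 2 / 4); lra.
Qed.

(** Here x^2 exp|x| <= 2 exp(2 |x|) <= 2 e^8 exp(x^2 / 8) by completing the square. Above the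
    threshold x^2 >= 64 i, hence x^2 / 8 <= x^2 / 4 - 8 i. *)
Lemma hard_threshold_exp_moment (i : nat) (l : R) : 0 <= l <= 1 ->
  mean_le N01 (fun x => (l * hard_threshold i x) ^+ 2 *
     expR `|l * hard_threshold i x|)
  (4 * expR 8 * l ^+ 2 * expR (- (8 * i%:R))).
Proof.
move=> /andP[l0 l1].
have k0 : 0 <= 2 * expR 8 * l ^+ 2 * expR (- (8 * i%:R)).
  by rewrite !mulr_ge0 ?expR_ge0 ?sqr_ge0.
rewrite (_ : 4 * _ * _ * _ = 2 * expR 8 * l ^+ 2 * expR (- (8 * i%:R)) * 2);
  last by ring.
apply: (mean_leW (mean_leZ k0 mean_le_expR_sqr)).
- have ml : measurable_fun setT (fun x => l * hard_threshold i x).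
    by apply: measurable_funM => //; exact: measurable_hard_threshold.
  apply: measurable_funM; first exact: measurable_funX.
  by do 2 apply: measurableT_comp => //.
- by move=> x; rewrite mulr_ge0 ?sqr_ge0 ?expR_ge0.
move=> x; rewrite /hard_threshold; case: ifP => [ti|_]; last first.
  by rewrite mulr0 expr0n mul0r mulr_ge0 ?expR_ge0.
have u0 : 0 <= `|x| by [].
have h1 : x ^+ 2 <= 2 * expR `|x|.
  have := expR_ge1Dxn 1 u0; rewrite (_ : 2`!%:R = 2 :> R)// sqr_abs; lra.
have h2 : expR `|l * x| <= expR `|x|.
  by rewrite ler_expR normrM (ger0_norm l0) ler_piMl.
have h3 : expR `|x| * expR `|x| <= expR 8 * expR (x ^+ 2 / 8).
  rewrite -!expRD ler_expR.
  have := sqr_ge0 (`|x| - 8); rewrite sqrrB sqr_abs; lra.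
have h4 : expR (x ^+ 2 / 8) <= expR (- (8 * i%:R)) * expR (x ^+ 2 / 4).
  by rewrite -expRD ler_expR; have := tau_lt_sqr ti; lra.
rewrite exprMn.
rewrite [leRHS](_ : _ = l ^+ 2 * (2 * (expR 8 * (expR (- (8 * i%:R)) * expR (x ^+ 2 / 4)))));
  last by ring.
rewrite -mulrA ler_wpM2l ?sqr_ge0//.
apply: (@le_trans _ _ (2 * expR `|x| * expR `|x|)).
  by rewrite ler_pM ?sqr_ge0 ?expR_ge0.
rewrite -mulrA ler_wpM2l//; apply: le_trans h3 _.
by rewrite ler_wpM2l ?expR_ge0.
Qed.

(** Boundedness of a band by its upper threshold allows l above 1, which the tail bound needs. The
    last factor pays for x^2 >= 64 i. *)
Lemma band_exp_moment (i : nat) (l : R) : 0 <= l ->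
  mean_le N01 (fun x => (l * band i x) ^+ 2 * expR `|l * band i x|)
  (2 * (l * tau i.+1) ^+ 2 * expR (l * tau i.+1) * expR (- (16 * i%:R))).
Proof.
move=> l0.
have lt0 : 0 <= l * tau i.+1 by rewrite mulr_ge0 ?tau_ge0.
have k0 : 0 <= (l * tau i.+1) ^+ 2 * expR (l * tau i.+1) * expR (- (16 * i%:R)).
  by rewrite !mulr_ge0 ?expR_ge0 ?sqr_ge0.
rewrite (_ : 2 * _ * _ * _ = (l * tau i.+1) ^+ 2 * expR (l * tau i.+1) *
  expR (- (16 * i%:R)) * 2); last by ring.
apply: (mean_leW (mean_leZ k0 mean_le_expR_sqr)).
- have ml : measurable_fun setT (fun x => l * band i x).
    by apply: measurable_funM => //; exact: measurable_band.
  apply: measurable_funM; first exact: measurable_funX.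
  by do 2 apply: measurableT_comp => //.
- by move=> x; rewrite mulr_ge0 ?sqr_ge0 ?expR_ge0.
move=> x; case: (band_spec i x) => [->|[ti tS ->]].
  by rewrite mulr0 expr0n mul0r mulr_ge0 ?expR_ge0.
have h : `|l * x| <= l * tau i.+1 by rewrite normrM (ger0_norm l0) ler_wpM2l.
have a1 : (l * x) ^+ 2 <= (l * tau i.+1) ^+ 2.
  by rewrite -sqr_abs lerXn2r ?nnegrE.
have a2 : expR `|l * x| <= expR (l * tau i.+1) by rewrite ler_expR.
have a3 : (l * x) ^+ 2 * expR `|l * x| <= (l * tau i.+1) ^+ 2 * expR (l * tau i.+1).
  by apply: ler_pM => //; exact: sqr_ge0.
apply: (le_trans a3); rewrite -[leRHS]mulrA ler_peMr//.
  by rewrite mulr_ge0 ?sqr_ge0 ?expR_ge0.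
rewrite -expRD -[leLHS]expR0 ler_expR; have := tau_lt_sqr ti; lra.
Qed.

End exponential_moments.

(** * The adaptive estimator *)

Section dyadic_levels.
Variable d : nat.

Definition levels : nat := trunc_log 4 (d * trunc_log 2 d).

(** The last bound needs K <= t, which follows from 4^K <= d t < 2^(t+1) 2^(t+1). *)
Lemma levels_bound : (2 <= d)%N ->
  [/\ (4 ^ levels <= d * trunc_log 2 d)%N, (d < 4 ^ levels.+1)%N &
      (d * levels < 4 ^ levels.+1)%N].
Proof.
rewrite /levels; set t := trunc_log 2 d; set K := trunc_log 4 _ => d2.
have t0 : (0 < t)%N by rewrite trunc_log_gt0.
have d0 : (0 < d)%N by apply: leq_trans d2.
have dt0 : (0 < d * t)%N by rewrite muln_gt0 d0.
have h1 : (4 ^ K <= d * t)%N by exact: trunc_logP.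
have h2 : (d * t < 4 ^ K.+1)%N by exact: trunc_log_ltn.
have hd : (d < 2 ^ t.+1)%N by exact: trunc_log_ltn.
have td : (t <= d)%N.
  apply: leq_trans (@trunc_logP 2 d isT d0).
  by apply: ltnW; rewrite ltn_expl.
have Kt : (K <= t)%N.
  rewrite -ltnS -(@ltn_exp2l 4)//; apply: leq_ltn_trans h1 _.
  rewrite (_ : 4 = 2 * 2)%N// expnMn; apply: ltn_mul => //.
  exact: leq_ltn_trans td hd.
split => //; first by apply: leq_ltn_trans h2; rewrite leq_pmulr.
by apply: leq_ltn_trans h2; rewrite leq_mul2l Kt orbT.
Qed.

End dyadic_levels.

Section estimator.
Context {R : realType}.
Variable d : nat.
Local Notation K := (levels d).
Implicit Types (x y z eta : d.-tuple R).

Definition cut (w b : R) : R := if w < `|b| then b else 0.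

Lemma cut_dist w b : 0 <= w -> `|cut w b - b| <= w.
Proof.
move=> w0; rewrite /cut; case: ltP => h; first by rewrite subrr normr0.
by rewrite sub0r normrN.
Qed.

(** If a + n survives the cut, then |n| > w / 2 >= |a|, so |a + n| <= 2 |n|. *)
Lemma cut_noise w a n : `|a| <= w / 2 ->
  `|cut w (a + n)| <= 2 * (if w / 2 < `|n| then `|n| else 0).
Proof.
move=> aw; have := ler_normD a n; have := normr_ge0 a; have := normr_ge0 n.
rewrite /cut; case: ltP => h1; case: ltP => h2; rewrite ?normr0; lra.
Qed.

(* The 256 e^8 is the constant for which the exponential moments of the noise
   in each band are at most exp (256 e^8 levels). *)
Definition cut_const : R := 256 * expR 8 + 4.

Definition band_cut (i : nat) : R :=
  2 * cut_const * (2 ^+ (K - i)%N * Num.sqrt i.+1%:R).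

Definition sum_est (y : d.-tuple R) : R :=
  \sum_(j < d) hard_threshold K (tnth y j) +
  \sum_(0 <= i < K) cut (band_cut i) (\sum_(j < d) band i (tnth y j)).

Lemma measurable_cut w : measurable_fun setT (cut w).
Proof.
apply: measurable_fun_ifT => //.
by apply: measurable_fun_ltr => //; exact: measurableT_comp.
Qed.

Lemma measurable_sum_est : measurable_fun setT sum_est.
Proof.
apply: measurable_funD.
  apply: measurable_sum => j.
  by apply: (measurableT_comp (measurable_hard_threshold _)); exact: measurable_tnth.
apply: measurable_sum => i; apply: (measurableT_comp (measurable_cut _)).
apply: measurable_sum => j.
by apply: (measurableT_comp (measurable_band _)); exact: measurable_tnth.
Qed.

Lemma sum_band (i : nat) (u : R) : (i <= K)%N ->
  hard_threshold K u + \sum_(i <= k < K) band k u = hard_threshold i u.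
Proof.
move=> iK; rewrite -[\sum_(_ <= _ < _) _]opprK -sumrN.
rewrite (eq_bigr (fun k => hard_threshold k.+1 u - hard_threshold k u)); last first.
  by move=> k _; rewrite opprB.
by rewrite telescope_sumr// opprB addrC subrK.
Qed.

Lemma cut_const_ge8 : 8 <= cut_const.
Proof. by rewrite /cut_const; have := @expR_ge1Dx R 8; lra. Qed.

Let c0 : 0 <= cut_const. Proof. by apply: le_trans cut_const_ge8. Qed.

Lemma band_cut_ge0 i : 0 <= band_cut i.
Proof. by rewrite /band_cut !mulr_ge0// exprn_ge0. Qed.

(** From one level to the next the cut shrinks by a factor at most 3/4, since 2^(K - k) halves and
    sqrt((k+2) / (k+1)) <= 3/2. Telescoping sums this geometric decay. *)
Lemma sum_band_cut (i : nat) : (i <= K)%N ->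
  \sum_(i <= k < K) band_cut k <= 4 * band_cut i.
Proof.
move=> iK.
apply: (@le_trans _ _ (\sum_(i <= k < K) (- (4 * band_cut k.+1) - - (4 * band_cut k)))).
  rewrite big_nat [leRHS]big_nat; apply: ler_sum => k /andP[_ kK].
  have KE : (K - k = (K - k.+1).+1)%N by rewrite -subSn.
  rewrite /band_cut KE exprS.
  set a := (2 ^+ _ : R).
  have a0 : 0 <= a by rewrite exprn_ge0.
  have h : 2 * Num.sqrt k.+2%:R <= 3 * Num.sqrt (k.+1%:R : R).
    rewrite -ler_sqr ?nnegrE ?mulr_ge0// !exprMn !sqr_sqrtr//.
    rewrite -[k.+2%:R]natr1.
    have : 1 <= k.+1%:R :> R by rewrite ler1n.
    lra.
  have := ler_wpM2l (mulr_ge0 c0 a0) h; lra.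
rewrite telescope_sumr// opprK addrC lerBlDr lerDl.
by rewrite mulr_ge0// band_cut_ge0.
Qed.

End estimator.

Lemma sqr_sum_le {R : realType} (I : finType) (A : {pred I}) (a : I -> R) :
  (\sum_(i in A) a i) ^+ 2 <= #|A|%:R * \sum_(i in A) a i ^+ 2.
Proof.
rewrite expr2 mulr_suml.
under eq_bigr do rewrite mulr_sumr.
apply: (@le_trans _ _ (\sum_(i in A) \sum_(j in A) (a i ^+ 2 / 2 + a j ^+ 2 / 2))).
  apply: ler_sum => i _; apply: ler_sum => j _.
  have := sqr_ge0 (a i - a j); rewrite sqrrB; lra.
under eq_bigr do rewrite big_split/= sumr_const.
rewrite big_split/= sumr_const sumrMnl -mulrnDl -big_split/=.
by under eq_bigr do rewrite -splitr; rewrite mulr_natl.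
Qed.

(** * Risk of [sum_est] at unit noise level *)

Section risk_of_estimator.
Context {R : realType}.
Variables (d s i0 : nat) (eta : d.-tuple R).
Local Notation K := (levels d).
Local Notation G := (gauss_noise R d).
Local Notation c := (@cut_const R).
Hypotheses (d2 : (2 <= d)%N) (eta_s : (norm0 eta <= s)%N).
Hypotheses (i0K : (i0 <= K)%N) (i0_min : forall i, (i < i0)%N -> (s < 2 ^ (K - i))%N).

Let S := [pred j | tnth eta j != 0].
(* At the lowest threshold i0 = 0 the estimator is the plain sum, whose error
   is pure noise even on the support. *)
Let S' := [pred j | (i0 != 0) && (j \in S)].

Let z (x : d.-tuple R) := shift_tuple (tnth eta) x.
Let main_noise (x : d.-tuple R) :=
  \sum_(j | j \in [predC S']) hard_threshold i0 (tnth x j).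
Let band_noise i (x : d.-tuple R) := \sum_(j | j \in [predC S]) band i (tnth x j).

(** If no band from [i0] up were cut, those bands and the top sum would telescope to hard
    thresholding at [i0]. The four terms are the error on the support, the noise off it, the cuts
    from [i0] up, and the noisy bands below. *)
Lemma sum_est_error x :
  `|sum_est (z x) - Lsum eta| <=
    \sum_(j in S') (`|tnth x j| + tau i0) + `|main_noise x| + 4 * band_cut d i0 +
    \sum_(0 <= i < i0) 2 * (if band_cut d i / 2 < `|band_noise i x|
                            then `|band_noise i x| else 0).
Proof.
pose D i := \sum_(j < d) band i (tnth (z x) j).
have -> : sum_est (z x) - Lsum eta =
    \sum_(j in S') (hard_threshold i0 (tnth (z x) j) - tnth eta j) + main_noise x
    + \sum_(i0 <= i < K) (cut (band_cut d i) (D i) - D i)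
    + \sum_(0 <= i < i0) cut (band_cut d i) (D i).
  have -> : \sum_(j in S') (hard_threshold i0 (tnth (z x) j) - tnth eta j) + main_noise x
      = \sum_(j < d) (hard_threshold i0 (tnth (z x) j) - tnth eta j).
    rewrite [RHS](bigID (mem S'))/=; congr (_ + _).
    apply: eq_bigr => j; rewrite !inE negb_and negbK /z tnth_mktuple.
    case/orP => [/eqP ->|/negPn/eqP ->]; last by rewrite addr0 subr0.
    by rewrite !hard_threshold0 addrK.
  have sumD : \sum_(i0 <= i < K) D i =
      \sum_(j < d) hard_threshold i0 (tnth (z x) j) -
      \sum_(j < d) hard_threshold K (tnth (z x) j).
    rewrite /D exchange_big/= -sumrB; apply: eq_bigr => j _.
    by rewrite -(sum_band (tnth (z x) j) i0K) addrAC subrr add0r.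
  rewrite /sum_est (@big_cat_nat _ _ _ i0)//= !sumrB sumD -/(Lsum eta).
  by ring.
apply: le_trans (ler_normD _ _) _; apply: lerD; last first.
  apply: le_trans (ler_norm_sum _ _ _) _.
  rewrite big_nat [leRHS]big_nat; apply: ler_sum => i /andP[_ ii0].
  have -> : D i = \sum_(j in S) band i (tnth (z x) j) + band_noise i x.
    rewrite /D (bigID (mem S))/=; congr (_ + _); apply: eq_bigr => j.
    by rewrite !inE negbK /z tnth_mktuple => /eqP ->; rewrite addr0.
  (* At most s < 2^(K - i) support coordinates, each at most 8 sqrt(i + 1) in the band, stay below
     half the cut because 8 <= c. *)
  apply: cut_noise; apply: le_trans (ler_norm_sum _ _ _) _.
  apply: (@le_trans _ _ (\sum_(j in S) tau i.+1)).
    by apply: ler_sum => j _; exact: band_le.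
  rewrite sumr_const -[leLHS]mulr_natl /band_cut /tau.
  rewrite [leRHS](_ : _ = 2 ^+ (K - i) * (c * Num.sqrt i.+1%:R)); last by field.
  apply: ler_pM => //.
    rewrite -natrX ler_nat; apply: leq_trans (ltnW (i0_min ii0)).
    exact: eta_s.
  by rewrite ler_wpM2r// cut_const_ge8.
apply: le_trans (ler_normD _ _) _; apply: lerD; last first.
  apply: le_trans (sum_band_cut i0K).
  apply: le_trans (ler_norm_sum _ _ _) _; apply: ler_sum => i _.
  by apply: cut_dist; exact: band_cut_ge0.
apply: le_trans (ler_normD _ _) _; apply: lerD => //.
apply: le_trans (ler_norm_sum _ _ _) _; apply: ler_sum => j _.
rewrite (_ : _ - _ = hard_threshold i0 (tnth (z x) j) - tnth (z x) j + tnth x j).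
  rewrite addrC; apply: le_trans (ler_normD _ _) _.
  by rewrite lerD2l; exact: hard_threshold_dist.
by rewrite /z tnth_mktuple; ring.
Qed.

Let sqr_abs (a : R) : `|a| ^+ 2 = a ^+ 2 := real_normK (num_real a).

Lemma sum_est_sqr_error x : (sum_est (z x) - Lsum eta) ^+ 2 <=
  4 * (#|S'|%:R * \sum_(j in S') 2 * (tnth x j ^+ 2 + tau i0 ^+ 2)
       + main_noise x ^+ 2 + (4 * band_cut d i0) ^+ 2
       + i0%:R * \sum_(i < i0) 4 * (if band_cut d i / 2 < `|band_noise i x|
                            then band_noise i x ^+ 2 else 0)).
Proof.
have := sum_est_error x; rewrite big_mkord.
set A1 := \sum_(j in S') _; set A2 := main_noise x; set A3 := 4 * _.
set A4 := \sum_(i < i0) _; set E := sum_est _ - _ => h.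
have b1 : A1 ^+ 2 <= #|S'|%:R * \sum_(j in S') 2 * (tnth x j ^+ 2 + tau i0 ^+ 2).
  apply: le_trans (sqr_sum_le _ _) _; rewrite ler_wpM2l//.
  apply: ler_sum => j _; have := sqr_ge0 (`|tnth x j| - tau i0).
  rewrite sqrrB sqrrD sqr_abs; lra.
have b4 : A4 ^+ 2 <= i0%:R * \sum_(i < i0) 4 * (if band_cut d i / 2 < `|band_noise i x|
                            then band_noise i x ^+ 2 else 0).
  have := sqr_sum_le (fun=> true) (fun i : 'I_i0 => 2 * (if band_cut d i / 2 < `|band_noise i x|
                            then `|band_noise i x| else 0)).
  rewrite card_ord => /le_trans; apply; rewrite ler_wpM2l//.
  apply: ler_sum => i _; case: ifP => _; rewrite ?mulr0 ?expr0n//.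
  by rewrite exprMn sqr_abs -natrX.
have E2 : E ^+ 2 <= (A1 + `|A2| + A3 + A4) ^+ 2.
  by rewrite -sqr_abs lerXn2r ?nnegrE// (le_trans _ h).
apply: le_trans E2 _.
have := sqr_abs A2; move: b1 b4.
have := sqr_ge0 (A1 - `|A2|); have := sqr_ge0 (A1 - A3); have := sqr_ge0 (A1 - A4).
have := sqr_ge0 (`|A2| - A3); have := sqr_ge0 (`|A2| - A4).
have := sqr_ge0 (A3 - A4); lra.
Qed.

(** The squared sparsity attached to level i; the rate there is of order Q i (i + 1). *)
Let Q i : R := (2 ^+ (K - i)) ^+ 2.

Let Q_gt0 i : 0 < Q i. Proof. by rewrite !exprn_gt0. Qed.

Let QK i : (i <= K)%N -> Q i * 4 ^+ i = 4 ^+ K.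
Proof.
move=> iK; rewrite /Q -exprM mulnC exprM -natrX.
by rewrite -exprD subnK.
Qed.

Let pow4_exp i : 4 ^+ i * expR (- (8 * i%:R)) <= 1 :> R.
Proof.
rewrite expRN ler_pdivrMr ?expR_gt0// mul1r mulrC expRM_natl.
rewrite lerXn2r ?nnegrE ?expR_ge0//.
by have := @expR_ge1Dx R 8; lra.
Qed.

Let d4K : d%:R <= 4 * 4 ^+ K :> R.
Proof.
have [_ h _] := levels_bound d2.
by rewrite -exprS -natrX ler_nat ltnW.
Qed.

Let dK4K : d%:R * K%:R <= 4 * 4 ^+ K :> R.
Proof.
have [_ _ h] := levels_bound d2.
by rewrite -exprS -natrX -natrM ler_nat ltnW.
Qed.

Let c8 : 8 <= c := @cut_const_ge8 R.

Lemma mean_le_tnth j (g : R -> R) (v : R) : mean_le (@normal_prob R 0 1) g v ->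
  mean_le G (fun x => g (tnth x j)) v.
Proof.
move=> [mg g0 gv]; split => //.
- by apply: (measurableT_comp mg); exact: measurable_tnth.
- by rewrite integral_gauss_noise_tnth.
Qed.

(** With l^2 = 1 / Q i0, the exponent d v / 2 is bounded: d / Q i0 is at most 4 * 4^i0, which exp(-8
    i0) absorbs. *)
Lemma main_noise_moment :
  mean_le G (fun x => main_noise x ^+ 2) (4 * expR (8 * expR 8) * Q i0).
Proof.
pose l : R := (2 ^+ (K - i0))^-1.
have l0 : 0 < l by rewrite invr_gt0 exprn_gt0.
have l1 : 0 <= l <= 1.
  by rewrite ltW//= invf_le1 ?exprn_gt0// exprn_ege1// ler1n.
have lQ : l ^+ 2 = (Q i0)^-1 by rewrite /l exprVn.
pose v : R := 4 * expR 8 * l ^+ 2 * expR (- (8 * i0%:R)).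
have v0 : 0 <= v.
  by rewrite /v; do !apply: mulr_ge0 => //; rewrite ?expR_ge0 ?tau_ge0 ?(ltW l0).
apply: (mean_le_trans (noise_second_moment [predC S']
  (measurable_hard_threshold i0) (hard_thresholdN i0) v0 l0
  (hard_threshold_exp_moment i0 l1))).
rewrite lQ invrK [leRHS]mulrAC ler_wpM2l ?mulr_ge0 ?(ltW (Q_gt0 _))// ler_expR.
rewrite /v lQ.
have h1 : d%:R / Q i0 * expR (- (8 * i0%:R)) <= 4.
  apply: (@le_trans _ _ (4 * (4 ^+ i0 * expR (- (8 * i0%:R))))); last first.
    by have := pow4_exp i0; lra.
  rewrite mulrA ler_wpM2r ?expR_ge0// ler_pdivrMr// -mulrA [_ * Q _]mulrC QK//.
have := ler_wpM2l (expR_ge0 8) h1; lra.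
Qed.

Let levels_le i : (i <= K)%N -> K%:R <= 2 ^+ (K - i) * i.+1%:R :> R.
Proof.
move=> iK; rewrite -natrX -natrM ler_nat.
rewrite -{1}(subnK iK); apply: (@leq_trans ((K - i).+1 * i.+1)).
  rewrite mulSn mulnS addSn addnA [(i + _)%N]addnC.
  exact: leqW (leq_addr _ _).
by rewrite leq_mul2r orbC ltn_expl.
Qed.

(** The choice of [l] makes l times half the cut equal to c K. As c exceeds 256 e^8 by 4, the
    Chernoff exponent is at most -4 K, against a squared half cut of at most c^2 exp(2 K). *)
Lemma band_noise_tail i : (i < K)%N ->
  mean_le G (fun x => if band_cut d i / 2 < `|band_noise i x|
                      then band_noise i x ^+ 2 else 0)
    (2 * c ^+ 2 * expR (- (2 * K%:R))).
Proof.
move=> iK.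
have K0 : 0 < K%:R :> R by rewrite ltr0n (leq_ltn_trans _ iK).
pose q : R := Num.sqrt i.+1%:R.
have q0 : 0 < q by rewrite sqrtr_gt0 ltr0n.
pose p : R := 2 ^+ (K - i).
have p0 : 0 < p by rewrite exprn_gt0.
pose l : R := K%:R / (p * q).
have l0 : 0 < l by rewrite divr_gt0// mulr_gt0.
have wE : band_cut d i / 2 = c * (p * q) by rewrite /band_cut -/p -/q; field.
have w0 : 0 < band_cut d i / 2 :> R.
  by rewrite wE !mulr_gt0// (lt_le_trans _ c8).
have lw : l * (band_cut d i / 2) = c * K%:R.
  by rewrite wE /l; field; rewrite !gt_eqF.
have K1 : 1 <= K%:R :> R by rewrite ler1n (leq_ltn_trans _ iK).
have lw2 : 2 <= l * (band_cut d i / 2) by rewrite lw; have := ler_pM (ler0n R 8) ler01 c8 K1; lra.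
have lt : l * tau i.+1 = 8 * K%:R / p.
  by rewrite /l /tau -/q; field; rewrite !gt_eqF.
pose v : R := 2 * (l * tau i.+1) ^+ 2 * expR (l * tau i.+1) * expR (- (16 * i%:R)).
have v0 : 0 <= v.
  do 2 (apply: mulr_ge0; last exact: expR_ge0).
  by apply: mulr_ge0 => //; exact: sqr_ge0.
apply: (mean_le_trans (noise_tail_moment [predC S]
  (measurable_band i) (bandN i) v0 (band_exp_moment i (ltW l0)) w0 lw2)).
(* Here l tau_(i+1) = 8 K / p <= 8 i + 8 by [levels_le], so half of the decay exp(-16 i) is left. *)
have h1 : expR (l * tau i.+1) * expR (- (16 * i%:R)) <= expR 8 * expR (- (8 * i%:R)).
  rewrite -!expRD ler_expR lt.
  have : 8 * K%:R / p <= 8 * i.+1%:R.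
    rewrite ler_pdivrMr// -mulrA ler_wpM2l// mulrC.
    by apply: levels_le; exact: ltnW.
  rewrite -[i.+1%:R]natr1; lra.
have h2 : d%:R * K%:R / Q i * expR (- (8 * i%:R)) <= 4.
  apply: (@le_trans _ _ (4 * (4 ^+ i * expR (- (8 * i%:R))))); last first.
    by have := pow4_exp i; lra.
  rewrite mulrA ler_wpM2r ?expR_ge0// ler_pdivrMr// -mulrA [_ * Q _]mulrC QK//.
  exact: ltnW.
have h3 : d%:R * v / 2 <= 256 * expR 8 * K%:R.
  rewrite /v lt -[_ / 2]/(_ * 2^-1).
  apply: (@le_trans _ _ (d%:R * ((8 * K%:R / p) ^+ 2 * (expR 8 * expR (- (8 * i%:R)))))).
    rewrite [leLHS](_ : _ = d%:R * ((8 * K%:R / p) ^+ 2 *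
      (expR (8 * K%:R / p) * expR (- (16 * i%:R))))); last by field; rewrite gt_eqF.
    rewrite -lt; apply: ler_wpM2l => //; apply: ler_wpM2l => //.
    exact: sqr_ge0.
  rewrite [leLHS](_ : _ = (64 * expR 8 * K%:R) *
     (d%:R * K%:R / Q i * expR (- (8 * i%:R)))); last first.
    by rewrite /Q -/p; field; rewrite gt_eqF.
  rewrite [leRHS](_ : _ = (64 * expR 8 * K%:R) * 4); last by ring.
  by rewrite ler_wpM2l// !mulr_ge0 ?expR_ge0.
have h4 : (band_cut d i / 2) ^+ 2 <= c ^+ 2 * expR (2 * K%:R).
  rewrite wE exprMn ler_wpM2l ?sqr_ge0// exprMn -/(Q i).
  rewrite sqr_sqrtr//.
  apply: (@le_trans _ _ (4 ^+ K)).
    rewrite -(QK (ltnW iK)); apply: ler_wpM2l; first exact: ltW.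
    by rewrite -natrX ler_nat ltn_expl.
  rewrite mulrC expRM_natl lerXn2r ?nnegrE ?expR_ge0//.
  have -> : expR 2 = expR 1 ^+ 2 :> R by rewrite -expRM_natl mulr1.
  by have := @expR_ge1Dx R 1; nra.
rewrite lw.
have h5 : expR (d%:R * v / 2 - c * K%:R) <= expR (- (4 * K%:R)).
  rewrite ler_expR; move: h3; rewrite /cut_const; lra.
have := ler_pM (sqr_ge0 _) (expR_ge0 _) h4 h5.
rewrite -[c ^+ 2 * _ * _]mulrA -expRD.
rewrite (_ : 2 * K%:R + - (4 * K%:R) = - (2 * K%:R)); last by ring.
lra.
Qed.

(** The 4 comes from squaring a sum of four terms; the summands bound, in order, the support, the
    main noise, the cuts from [i0] up and the bands below. *)
Definition risk_const : R :=
  4 * (512 + 4 * expR (8 * expR 8) + 64 * c ^+ 2 + 8 * c ^+ 2).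

Lemma sum_est_mean_error :
  mean_le G (fun x => (sum_est (z x) - Lsum eta) ^+ 2)
    (risk_const * (Q i0 * i0.+1%:R)).
Proof.
have i01 : 1 <= i0.+1%:R :> R by rewrite ler1n.
have Q1 : 1 <= Q i0 by rewrite /Q !exprn_ege1// ler1n.
set M := Q i0 * i0.+1%:R.
have QM : Q i0 <= M by rewrite /M ler_peMr// ltW.
have M1 : 1 <= M by apply: le_trans Q1 QM.
have m1 : mean_le G (fun x => #|S'|%:R * \sum_(j in S') 2 * (tnth x j ^+ 2 + tau i0 ^+ 2))
    (#|S'|%:R * \sum_(j in S') 2 * (8 + tau i0 ^+ 2)).
  apply: mean_leZ => //; apply: mean_le_sum => j _; apply: mean_leZ => //.
  apply: mean_leD; last by apply: mean_le_cst; exact: sqr_ge0.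
  apply: (@mean_le_tnth j (fun u => u ^+ 2)); exact: mean_le_sqr.
have m4 : mean_le G (fun x => i0%:R * \sum_(i < i0) 4 *
      (if band_cut d i / 2 < `|band_noise i x| then band_noise i x ^+ 2 else 0))
    (i0%:R * \sum_(i < i0) 4 * (2 * c ^+ 2 * expR (- (2 * K%:R)))).
  apply: mean_leZ => //; apply: mean_le_sum => i _; apply: mean_leZ => //.
  by apply: band_noise_tail; apply: leq_trans i0K.
have m3 : mean_le G (cst ((4 * band_cut d i0) ^+ 2)) ((4 * band_cut d i0) ^+ 2).
  by apply: mean_le_cst; exact: sqr_ge0.
have m := mean_leZ (ler0n R 4) (mean_leD (mean_leD (mean_leD m1 main_noise_moment) m3) m4).
apply: (mean_le_trans (mean_leW m _ _ _)).
- apply: measurable_funX; apply: measurable_funB => //.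
  apply: (measurableT_comp (@measurable_sum_est R d)).
  exact: measurable_shift_tuple.
- by move=> x; exact: sqr_ge0.
- exact: sum_est_sqr_error.
have b1 : #|S'|%:R * \sum_(j in S') 2 * (8 + tau i0 ^+ 2) <= 512 * M.
  case: (eqVneq i0 0%N) => [i00|i00].
    rewrite (@eq_card0 _ S') => [|j]; last by rewrite !inE i00.
    by rewrite mul0r mulr_ge0// (le_trans ler01 M1).
  rewrite sumr_const -[X in _ * X]mulr_natl tau_sqr.
  (* For i0 > 0, [i0_min] at i0 - 1 gives s < 2^(K - i0 + 1); for i0 = 0 the set [S'] was empty. *)
  have hs : #|S'|%:R <= 2 * 2 ^+ (K - i0) :> R.
    rewrite -exprS -natrX ler_nat.
    have i0gt : (i0.-1 < i0)%N by rewrite prednK// lt0n.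
    have := i0_min i0gt; rewrite -subn1 subnBA ?lt0n// addn1 subSn// => h.
    apply: leq_trans (ltnW h); apply: leq_trans eta_s.
    by apply: subset_leq_card; apply/fintype.subsetP => j; rewrite !inE => /andP[].
  have hs2 : #|S'|%:R * #|S'|%:R <= 4 * Q i0 :> R.
    rewrite [leRHS](_ : _ = (2 * 2 ^+ (K - i0)) * (2 * 2 ^+ (K - i0))).
      exact: ler_pM.
    by rewrite /Q; ring.
  rewrite mulrA [leRHS](_ : _ = (4 * Q i0) * (2 * (64 * i0.+1%:R))); last first.
    by rewrite /M; ring.
  apply: ler_pM => //.
  by rewrite -[i0.+1%:R]natr1; lra.
have b3 : (4 * band_cut d i0) ^+ 2 = 64 * c ^+ 2 * M :> R.
  rewrite /band_cut /M /Q !exprMn sqr_sqrtr//; ring.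
have b4 : i0%:R * \sum_(i < i0) 4 * (2 * c ^+ 2 * expR (- (2 * K%:R))) <= 8 * c ^+ 2 * M.
  rewrite sumr_const card_ord -[X in _ * X]mulr_natl.
  have iK : i0%:R <= expR K%:R :> R.
    apply: (@le_trans _ _ K%:R); first by rewrite ler_nat.
    by have := expR_ge1Dx (K%:R : R); lra.
  have h : i0%:R * i0%:R * expR (- (2 * K%:R)) <= 1 :> R.
    rewrite expRN ler_pdivrMr ?expR_gt0// mul1r (expRM_natl 2) expr2.
    exact: ler_pM.
  have := ler_wpM2l (sqr_ge0 c) h; have := ler_wpM2l (sqr_ge0 c) M1; lra.
have e0 := expR_ge0 (8 * expR 8 : R).
have b2 := ler_wpM2l e0 QM.
rewrite /risk_const b3; lra.
Qed.

End risk_of_estimator.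

(** * Rescaling to noise level sigma and comparison with the rate *)

Section adaptive_estimator.
Context {R : realType}.
Variable sigma : R.
Hypothesis sigma0 : 0 < sigma.

Definition rescale_tuple (d : nat) (y : d.-tuple R) : d.-tuple R :=
  [tuple tnth y j / sigma | j < d].

Definition adaptive_est_fun (d : nat) (y : d.-tuple R) : R :=
  sigma * sum_est (rescale_tuple y).

Lemma measurable_adaptive_est (d : nat) :
  measurable_fun setT (@adaptive_est_fun d).
Proof.
apply: measurable_funM => //; apply: (measurableT_comp (@measurable_sum_est R d)).
apply/measurable_fun_tnthP => j.
rewrite (_ : _ \o _ = fun x => tnth x j / sigma).
  by apply: measurable_funM => //; exact: measurable_tnth.
by apply/funext => x /=; rewrite tnth_mktuple.
Qed.

HB.instance Definition _ (d : nat) := isMeasurableFun.Build _ _ _ _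
  (@adaptive_est_fun d) (@measurable_adaptive_est d).

Definition adaptive_est (d : nat) : estimator R d := @adaptive_est_fun d.

(** The base 5/4 gives equality at i = 0, and growth by 4 dominates growth by 5/4 afterwards. *)
Lemma ln1D_pow4 (i : nat) : i.+1%:R * ln (5 / 4) <= ln (1 + 4 ^+ i / 4) :> R.
Proof.
have h : (5 / 4) ^+ i.+1 <= 1 + 4 ^+ i / 4 :> R.
  elim: i => [|i IH]; first by rewrite expr1 expr0; lra.
  rewrite exprS [4 ^+ i.+1]exprS.
  have : 1 <= 4 ^+ i :> R by rewrite exprn_ege1// ler1n.
  lra.
rewrite mulr_natl -lnXn ?divr_gt0// ler_ln// posrE.
  by rewrite exprn_gt0// divr_gt0.
by rewrite ltr_pwDl// divr_ge0// exprn_ge0.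
Qed.

(** The integer logarithm is at most 2 ln d, because ln 2 >= 1/2. *)
Lemma pow4_levels_le (d : nat) : (2 <= d)%N ->
  4 ^+ levels d / 4 <= d%:R * ln d%:R :> R.
Proof.
move=> d2; have d0 : (0 < d)%N by apply: leq_trans d2.
have [h _ _] := levels_bound d2.
set t := trunc_log 2 d in h.
have ln2 : 1 / 2 <= ln 2 :> R.
  have h2 : -1 < - 2^-1 :> R by lra.
  have := le_ln1Dx h2; rewrite (_ : 1 + - 2^-1 = 2^-1); last by field.
  rewrite lnV ?posrE//; lra.
have ht : t%:R * ln 2 <= ln d%:R :> R.
  rewrite mulr_natl -lnXn// ler_ln ?posrE ?exprn_gt0 ?ltr0n//.
  by rewrite -natrX ler_nat; exact: trunc_logP.
have h' : 4 ^+ levels d <= d%:R * t%:R :> R by rewrite -natrX -natrM ler_nat.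
have dR : 0 <= d%:R :> R by [].
have tR : 0 <= t%:R :> R by [].
have := mulr_ge0 dR tR.
have := ler_wpM2l dR (le_trans (ler_wpM2l tR ln2) ht); lra.
Qed.

Lemma PhiL_level_le (d s i : nat) : (2 <= d)%N -> (i <= levels d)%N ->
  (2 ^ (levels d - i) <= s)%N ->
  sigma ^+ 2 * ((2 ^+ (levels d - i)) ^+ 2 * i.+1%:R) * ln (5 / 4) <= PhiL sigma d s.
Proof.
move=> d2 iK hs; pose U : R := (2 ^+ (levels d - i)) ^+ 2; rewrite -/U /PhiL.
rewrite -[leLHS]mulrA -[leRHS]mulrA; apply: ler_wpM2l; first exact: sqr_ge0.
rewrite -mulrA.
have U0 : 0 < U by rewrite !exprn_gt0.
have US : U <= s%:R ^+ 2 by rewrite lerXn2r ?nnegrE ?exprn_ge0// -natrX ler_nat.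
have D0 : 0 <= d%:R * ln d%:R :> R.
  by rewrite mulr_ge0// ln_ge0// ler1n; apply: leq_trans d2.
apply: (le_trans _ (PhiL_mono U0 US D0)).
rewrite ler_wpM2l ?(ltW U0)//; apply: le_trans (ln1D_pow4 i) _.
rewrite ler_ln ?posrE; last 2 first.
- by rewrite ltr_pwDl// divr_ge0// exprn_ge0.
- by rewrite ltr_pwDl// divr_ge0// ltW.
rewrite lerD2l ler_pdivlMr//; apply: le_trans (pow4_levels_le d2).
have e4 : 2 ^+ 2 = 4 :> R by rewrite -natrX.
have -> : 4 ^+ levels d = U * 4 ^+ i.
  by rewrite -{1}(subnK iK) exprD -e4; congr (_ * _); rewrite /U -!exprM mulnC.
by rewrite [leLHS]mulrC mulrA.
Qed.

Lemma risk_adaptive_est (d s i0 : nat) (theta : d.-tuple R) : (2 <= d)%N ->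
  (norm0 theta <= s)%N -> (i0 <= levels d)%N ->
  (forall i, (i < i0)%N -> (s < 2 ^ (levels d - i))%N) ->
  (risk sigma (adaptive_est d) theta <=
   (sigma ^+ 2 * (risk_const * ((2 ^+ (levels d - i0)) ^+ 2 * i0.+1%:R)))%:E)%E.
Proof.
move=> d2 ths i0K i0_min.
pose eta := rescale_tuple theta.
have etaE j : tnth eta j = tnth theta j / sigma by rewrite tnth_mktuple.
have eta_s : (norm0 eta <= s)%N.
  apply: leq_trans ths; apply: subset_leq_card; apply/fintype.subsetP => j.
  by rewrite !inE etaE; apply: contraNN => /eqP ->; rewrite mul0r.
have := mean_leZ (sqr_ge0 sigma) (sum_est_mean_error d2 eta_s i0K i0_min).
case=> _ _; apply: le_trans; rewrite riskE le_eqVlt; apply/orP; left; apply/eqP.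
apply: eq_integral => x _; congr EFin.
rewrite -exprMn mulrBr; congr ((_ - _) ^+ 2).
  congr (sigma * sum_est _); apply: eq_from_tnth => j.
  rewrite !tnth_mktuple mulrDl addrC mulrAC divff ?mul1r//.
  by rewrite gt_eqF.
rewrite /Lsum mulr_sumr; apply: eq_bigr => j _.
by rewrite etaE mulrCA divff ?mulr1// gt_eqF.
Qed.

Lemma adaptive_est_upper_bound : adaptive_upper_bound sigma (PhiL sigma).
Proof.
have ln54 : 0 < ln (5 / 4) :> R by rewrite ln_gt0//; lra.
have rc0 : 0 < risk_const :> R.
  rewrite /risk_const; have := @expR_gt0 R (8 * expR 8).
  have := sqr_ge0 (@cut_const R); lra.
exists adaptive_est; exists (risk_const / ln (5 / 4)); first by rewrite divr_gt0.
move=> d d2; rewrite /max_risk big_nat.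
apply: bigmax_le => [|s /andP[s1 sd]]; first by rewrite leNye.
apply: ub_ereal_sup => _ [theta ths <-].
have Phi0 : 0 < PhiL sigma d s by apply: PhiL_gt0 => //; rewrite s1.
rewrite lee_pdivrMr//.
(* The least level with 2^(K - i) <= s serves as [i0]; it enters the analysis only, so the estimator
   does not depend on s. *)
have ex : exists i, (2 ^ (levels d - i) <= s)%N by exists (levels d); rewrite subnn.
case: (ex_minnP ex) => i hi imin.
have iK : (i <= levels d)%N by apply: imin; rewrite subnn.
have i_min k : (k < i)%N -> (s < 2 ^ (levels d - k))%N.
  by move=> ki; rewrite ltnNge; apply/negP => /imin; rewrite leqNgt ki.
apply: le_trans (risk_adaptive_est d2 ths iK i_min) _.
rewrite -EFinM lee_fin [leRHS]mulrAC ler_pdivlMr//.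
have := ler_wpM2l (ltW rc0) (PhiL_level_le d2 iK hi); lra.
Qed.

End adaptive_estimator.

Theorem corollary1 (R : realType) (sigma : R) (hsigma : 0 < sigma) :
  adaptive_rate sigma (PhiL sigma).
Proof.
split.
- by move=> d s d2 s1; apply: PhiL_gt0.
- exact: adaptive_est_upper_bound.
- exact: PhiL_optimality.
Qed.
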